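(* The IB termination problem is decidable for FIFO machines: given a FIFO machine $M=(Q,\mathit{Ch},\Sigma,\Delta,q_0)$ and a tuple $(L_c)_{c\in\mathit{Ch}}$ of non-empty regular bounded languages $L_c\subseteq\Sigma_c^\ast$, it is decidable whether there is no infinite execution $s_0\xrightarrow{\beta_1}s_1\xrightarrow{\beta_2}s_2\xrightarrow{\beta_3}\cdots$ from the initial configuration $s_0$ with $\beta_i\in A_M$ and $\beta_1\cdots\beta_i\in\mathrm{Pref}(L_!)$ for all $i$.
   Context: A bounded language over non-empty words $(w_1,\ldots,w_n)$ is a language $L\subseteq w_1^\ast\cdots w_n^\ast$. A FIFO machine is $M=(Q,\mathit{Ch},\Sigma,\Delta,q_0)$ with finite control states $Q$, initial state $q_0$, finite channels $\mathit{Ch}$, alphabet $\Sigma=\biguplus_c\Sigma_c$, and $\Delta\subseteq Q\times A_M\times Q$, $A_M=\{c!a,c?a\mid c\in\mathit{Ch},a\in\Sigma_c\}$. Configurations $(q,\mathbf{w})$ with $\mathbf{w}\in\prod_c\Sigma_c^\ast$; initial $(q_0,(\varepsilon)_c)$. A send $c!a$ appends $a$ to channel $c$; a receive $c?a$ removes $a$ from the head of channel $c$ (only possible if $a$ is at the head); other channels unchanged; the control state moves along a transition of $\Delta$. $L_!=\{\sigma\in A_M^\ast\mid\mathrm{proj}_{c!}(\sigma)\in L_c\ \forall c\}$, where $\mathrm{proj}_{c!}$ keeps the messages of send actions on $c$ and erases all other actions. $\mathrm{Pref}(L)$ is the set of prefixes of words in $L$. *)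

(* Defs.v *)
From mathcomp Require Import all_boot.
Set Implicit Arguments. Unset Strict Implicit. Unset Printing Implicit Defensive.

(* Model of computation: counter (Minsky) machines with unboundedly    *)
(* many registers.  "Decidable" = some counter machine program, run on  *)
(* the (pickle-)encoding of the input in register 0, always halts with  *)
(* register 0 equal to 1 (yes) or 0 (no), correctly.                    *)

Inductive cm_instr :=
| CInc of nat
| CDec of nat & nat.

Definition cm_conf := (nat * (nat -> nat))%type.

Definition upd (r : nat -> nat) (k v : nat) : nat -> nat :=
  fun x => if x == k then v else r x.

Definition cm_step (P : seq cm_instr) (c : cm_conf) : cm_conf :=
  let: (pc, r) := c in
  if pc < size P then
    match nth (CInc 0) P pc with
    | CInc k => (pc.+1, upd r k (r k).+1)
    | CDec k j => match r k with
                  | m.+1 => (pc.+1, upd r k m)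
                  | 0 => (j, r)
                  end
    end
  else c.

Definition cm_init (n : nat) : cm_conf := (0, fun x => if x == 0 then n else 0).

Definition cm_decides (P : seq cm_instr) (n : nat) (Q : Prop) : Prop :=
  exists t, let c := iter t (cm_step P) (cm_init n) in
    size P <= c.1 /\ ((c.2 0 = 1 /\ Q) \/ (c.2 0 = 0 /\ ~ Q)).

(* FIFO machines, with states 0..nQ-1 (q0 = 0), channels 0..nC-1, and  *)
(* Sigma_c = {0..alph_c - 1} (the disjoint union is realized by pairing *)
(* letters with their channel in actions).                              *)

(* an action: (channel c, is_send, letter a) : c!a if is_send, else c?a *)
Definition action := (nat * bool * nat)%type.
Definition act_ch (x : action) := x.1.1.
Definition act_send (x : action) := x.1.2.
Definition act_letter (x : action) := x.2.

Record fifo := Fifo {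
  nQ : nat;
  nC : nat;
  alph : seq nat;                         (* alph`_c = |Sigma_c| *)
  delta : seq (nat * action * nat)
}.

Definition valid_action (M : fifo) (x : action) : bool :=
  (act_ch x < nC M) && (act_letter x < nth 0 (alph M) (act_ch x)).

Definition wf_fifo (M : fifo) : Prop :=
  0 < nQ M /\ size (alph M) = nC M /\
  all (fun t => [&& t.1.1 < nQ M, t.2 < nQ M & valid_action M t.1.2]) (delta M).

(* configurations: control state and one word per channel *)
Definition config := (nat * seq (seq nat))%type.

Definition init_config (M : fifo) : config := (0, nseq (nC M) [::]).

Definition fstep (M : fifo) (s : config) (b : action) (s' : config) : Prop :=
  (s.1, b, s'.1) \in delta M /\
  let c := act_ch b in let a := act_letter b in
  if act_send b then
    s'.2 = set_nth [::] s.2 c (rcons (nth [::] s.2 c) a)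
  else
    nth [::] s.2 c = a :: nth [::] s'.2 c /\
    s'.2 = set_nth [::] s.2 c (nth [::] s'.2 c).

Record nfa := Nfa {
  nst : nat;
  ninit : seq nat;
  nfin : seq nat;
  ntrans : seq (nat * nat * nat)
}.

Fixpoint acc_from (A : nfa) (p : nat) (u : seq nat) : Prop :=
  match u with
  | [::] => p \in nfin A
  | a :: u' => exists p', ((p, a, p') \in ntrans A) /\ acc_from A p' u'
  end.

Definition nfa_lang (A : nfa) (u : seq nat) : Prop :=
  exists2 p, p \in ninit A & acc_from A p u.

Definition wf_nfa (k : nat) (A : nfa) : Prop :=
  all (fun p => p < nst A) (ninit A) /\ all (fun p => p < nst A) (nfin A) /\
  all (fun t => [&& t.1.1 < nst A, t.1.2 < k & t.2 < nst A]) (ntrans A).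

Definition in_bounded (ws : seq (seq nat)) (u : seq nat) : Prop :=
  exists ks : seq nat, size ks = size ws /\
    u = flatten [seq flatten (nseq p.2 p.1) | p <- zip ws ks].

Definition bounded_lang (L : seq nat -> Prop) : Prop :=
  exists ws : seq (seq nat), all (fun w => w != [::]) ws /\
    forall u, L u -> in_bounded ws u.

Definition proj_send (c : nat) (s : seq action) : seq nat :=
  [seq act_letter x | x <- s & (act_ch x == c) && act_send x].

Definition in_Lsend (M : fifo) (Ls : seq nfa) (s : seq action) : Prop :=
  forall c, c < nC M -> nfa_lang (nth (Nfa 0 [::] [::] [::]) Ls c) (proj_send c s).

Definition in_Pref_Lsend (M : fifo) (Ls : seq nfa) (s : seq action) : Prop :=
  exists s' : seq action, all (valid_action M) s' /\ in_Lsend M Ls (s ++ s').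

Definition IB_terminates (M : fifo) (Ls : seq nfa) : Prop :=
  ~ exists (s : nat -> config) (b : nat -> action),
      s 0 = init_config M /\
      forall i, fstep M (s i) (b i) (s i.+1) /\
                valid_action M (b i) /\
                in_Pref_Lsend M Ls (mkseq b i.+1).

Definition wf_langs (M : fifo) (Ls : seq nfa) : Prop :=
  size Ls = nC M /\
  forall c, c < nC M ->
    let A := nth (Nfa 0 [::] [::] [::]) Ls c in
    wf_nfa (nth 0 (alph M) c) A /\ (exists u, nfa_lang A u) /\
    bounded_lang (nfa_lang A).

Definition encode (M : fifo) (Ls : seq nfa) :=
  ((nQ M, nC M, alph M, delta M),
   [seq (nst A, ninit A, nfin A, ntrans A) | A <- Ls]).

Definition code (M : fifo) (Ls : seq nfa) : nat := pickle (encode M Ls).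

(* Main.v *)
Require Import Defs.
From mathcomp Require Import all_boot zify.
From Stdlib Require Import Classical ClassicalEpsilon.
Set Implicit Arguments. Unset Strict Implicit. Unset Printing Implicit Defensive.

(* Both answers have finite certificates, so an unbounded search decides.

   Termination: by Koenig's lemma, every execution has length less than some n.

   Non-termination: an execution l and an index k such that the transitions of
   l after position k can be repeated N times, N being large with respect to l
   and to the automata. Such a certificate yields an infinite execution: along
   the iteration the words sent and received on a channel are eventually
   periodic, and they agree on more than one common period, hence everywhere;
   the automata constraints are preserved by the pumping lemma. Conversely,
   along an infinite execution each word sent lies in a bounded language, hence
   is eventually periodic, so that what matters of a channel is its length and
   two positions modulo a period. Dickson's lemma gives two instants with equal
   control data and nondecreasing channel lengths, and the transitions between
   them can be repeated forever.

   The search is run by a counter machine obtained by compiling primitive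
   recursive terms; data are represented by their [pickle] codes, for which the
   code of a list is a binary pairing [2 ^ h * (2 * t + 1)] of head and tail. *)

(** * Counter machine programs *)

Arguments cm_step : simpl never.

Inductive prog :=
| Inc of nat
| Dec of nat
| Seq of prog & prog
| While of nat & prog.

Inductive bigstep : prog -> (nat -> nat) -> (nat -> nat) -> Prop :=
| BInc k r : bigstep (Inc k) r (upd r k (r k).+1)
| BDec k r : bigstep (Dec k) r (upd r k (r k).-1)
| BSeq p q r r1 r2 : bigstep p r r1 -> bigstep q r1 r2 -> bigstep (Seq p q) r r2
| BWhile0 k p r : r k = 0 -> bigstep (While k p) r r
| BWhileS k p r r1 r2 : r k != 0 -> bigstep p r r1 ->
    bigstep (While k p) r1 r2 -> bigstep (While k p) r r2.

(* Machine register 1 is kept at zero, so that [CDec 1 j] is an unconditional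
   jump; program register k > 0 lives in machine register k + 1. *)
Definition reg k := if k is k'.+1 then k'.+2 else 0.

Fixpoint plen p :=
  match p with
  | Inc _ | Dec _ => 1
  | Seq p q => plen p + plen q
  | While _ p => (plen p).+3
  end.

(** [o] is the address at which the code is loaded, jump targets being absolute. When the loop test
    [CDec] does not jump it spends one unit of the tested register, which the following [CInc] gives
    back. *)
Fixpoint assemble p o : seq cm_instr :=
  match p with
  | Inc k => [:: CInc (reg k)]
  | Dec k => [:: CDec (reg k) o.+1]
  | Seq p q => assemble p o ++ assemble q (o + plen p)
  | While k p => CDec (reg k) (o + (plen p).+3) :: CInc (reg k) ::
                 assemble p o.+2 ++ [:: CDec 1 o]
  end.

Lemma size_assemble p o : size (assemble p o) = plen p.
Proof.
elim: p o => //= [p IHp q IHq|k p IHp] o; first by rewrite size_cat IHp IHq.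
by rewrite size_cat IHp addn1.
Qed.

Definition sim (r m : nat -> nat) := m 1 = 0 /\ forall k, m (reg k) = r k.

Lemma reg_inj : injective reg.
Proof. by move=> [|x] [|y] //= [->]. Qed.

Lemma sim_upd r m k v : sim r m -> sim (upd r k v) (upd m (reg k) v).
Proof.
move=> [m1 mr]; split; first by rewrite /upd; case: k.
by move=> x; rewrite /upd (inj_eq reg_inj) mr.
Qed.

Lemma assembleP p r r' : bigstep p r r' -> forall P o pre post m,
  P = pre ++ assemble p o ++ post -> size pre = o -> sim r m ->
  exists t m', iter t (cm_step P) (o, m) = (o + plen p, m') /\ sim r' m'.
Proof.
have fetch P pre i post m : P = pre ++ i :: post ->
    cm_step P (size pre, m) = match i with
      | CInc k => ((size pre).+1, upd m k (m k).+1)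
      | CDec k j => match m k with
                    | v.+1 => ((size pre).+1, upd m k v)
                    | 0 => (j, m) end end.
  move=> ->; rewrite /cm_step size_cat /= addnS ltnS leq_addr.
  by rewrite nth_cat ltnn subnn.
elim=> {p r r'} [k r|k r|p q r r1 r2 _ IHp _ IHq|k p r r0|k p r r1 r2 rk _ IHp _ IHw]
  P o pre post m defP so sm; subst o.
- exists 1, (upd m (reg k) (m (reg k)).+1); rewrite /= (fetch _ _ _ _ _ defP) addn1.
  by split=> //; rewrite (proj2 sm); apply: sim_upd.
- exists 1; rewrite /= (fetch _ _ _ _ _ defP) addn1 (proj2 sm).
  case rk: (r k) => [|v]; last by eexists; split; first by []; apply: sim_upd.
  exists m; split=> //; split; first exact: (proj1 sm).
  by move=> x; rewrite (proj2 sm) /upd; case: eqP => // ->.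
- have [|t1 [m1 [e1 s1]]] := IHp P _ pre (assemble q (size pre + plen p) ++ post) m _ erefl sm.
    by rewrite defP /= -!catA.
  have [||t2 [m2 [e2 s2]]] := IHq P (size pre + plen p) (pre ++ assemble p (size pre)) post m1 _ _ s1.
  + by rewrite defP /= -!catA.
  + by rewrite size_cat size_assemble.
  by exists (t2 + t1), m2; rewrite iterD e1 e2 /= addnA.
- exists 1, m; rewrite /= (fetch _ _ _ _ _ defP) (proj2 sm) r0.
  by [].
(* Test and restoration take two steps. The register file reached agrees with [m] pointwise, which
   is all that [sim] compares. *)
- set o := size pre; have e1 : iter 2 (cm_step P) (o, m) = (o.+2, upd (upd m (reg k) (r k).-1) (reg k) (r k)).
    rewrite /= (fetch _ _ _ _ _ defP) (proj2 sm).
    case: (r k) rk => // v _.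
    have := fetch P (rcons pre (CDec (reg k) (size pre + (plen p).+3))) (CInc (reg k))
      ((assemble p (size pre).+2 ++ [:: CDec 1 (size pre)]) ++ post)
      (upd m (reg k) v).
    rewrite size_rcons => ->; last by rewrite defP cat_rcons.
    by rewrite /upd eqxx.
  have [|||t1 [m1 [e2 s1]]] := IHp P o.+2
    (pre ++ [:: CDec (reg k) (o + (plen p).+3); CInc (reg k)]) (CDec 1 o :: post)
    (upd (upd m (reg k) (r k).-1) (reg k) (r k)).
  + by rewrite defP /= -!catA /=.
  + by rewrite size_cat addn2.
  + split; first by rewrite /upd; case: (k) => //=; case: sm.
    move=> x; rewrite /upd (inj_eq reg_inj); case: eqP => [->|_] //.
    exact: (proj2 sm).
  have [t2 [m2 [e3 s2]]] := IHw P o pre post m1 defP erefl s1.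
  exists (t2 + (1 + (t1 + 2))), m2; split=> //.
  rewrite iterD (iterD 1) (iterD t1) e1 e2 -e3; congr iter.
  have -> : o.+2 + plen p =
     size (pre ++ CDec (reg k) (o + (plen p).+3) :: CInc (reg k) :: assemble p o.+2).
    by rewrite size_cat /= size_assemble; lia.
  rewrite /= (fetch _ _ (CDec 1 o) post); first by rewrite (proj1 s1).
  by rewrite defP /= -!catA.
Qed.

Definition runs (pre : (nat -> nat) -> Prop) p (post : (nat -> nat) -> Prop) :=
  forall r, pre r -> exists2 r', bigstep p r r' & post r'.

Lemma runs_while k p (I : nat -> (nat -> nat) -> Prop) :
  (forall n, runs (fun r => I n.+1 r /\ r k = n.+1) p (fun r => I n r /\ r k = n)) ->
  forall n, runs (fun r => I n r /\ r k = n) (While k p) (fun r => I 0 r /\ r k = 0).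
Proof.
move=> hp; elim=> [|n IHn] r [In rk]; first by exists r => //; exact: BWhile0.
have [r1 b1 I1] := hp _ _ (conj In rk).
have [r2 b2 I2] := IHn _ I1; exists r2 => //.
by apply: BWhileS b1 b2; rewrite rk.
Qed.

Lemma bigstep_iter k p g : (forall r, bigstep p r (g r)) ->
  (forall r, g r k = (r k).-1) -> forall r, bigstep (While k p) r (iter (r k) g r).
Proof.
move=> pg gk r; move rk: (r k) => n; elim: n r rk => [|n IHn] r rk; first exact: BWhile0.
rewrite iterSr; apply: BWhileS (pg r) _; first by rewrite rk.
by apply: IHn; rewrite gk rk.
Qed.

Definition clear k := While k (Dec k).

Lemma clearP k r : exists2 r', bigstep (clear k) r r' &
  r' k = 0 /\ forall x, x != k -> r' x = r x.
Proof.
exists (iter (r k) (fun r => upd r k (r k).-1) r).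
  by apply: bigstep_iter => r1; [exact: BDec | rewrite /upd eqxx].
have it n x : iter n (fun r => upd r k (r k).-1) r x = if x == k then r k - n else r x.
  elim: n x => [|n IHn] x /=; first by case: eqP => // ->; rewrite subn0.
  by rewrite {1}/upd !IHn eqxx; case: eqP => // _; rewrite subnS.
by split=> [|x /negPf xk]; rewrite it ?eqxx ?subnn ?xk.
Qed.

Definition transfer a b := Seq (clear b) (While a (Seq (Dec a) (Inc b))).

Lemma transferP a b r : a != b -> exists2 r', bigstep (transfer a b) r r' &
  r' b = r a /\ forall x, x != a -> x != b -> r' x = r x.
Proof.
move=> ab; have [r1 b1 [r1b r1x]] := clearP b r.
pose g r := upd (upd r a (r a).-1) b (upd r a (r a).-1 b).+1.
exists (iter (r1 a) g r1).
  apply: BSeq b1 (bigstep_iter _ _ _) => r2; first by apply: BSeq (BDec _ _) (BInc _ _).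
  by rewrite /g /upd (negPf ab) eqxx.
have it n x : iter n g r1 x = if x == b then n else if x == a then r1 a - n else r1 x.
  elim: n x => [|n IHn] x /=; first by rewrite subn0; case: (x =P b) => [->//|_]; case: (x =P a) => [->|].
  rewrite /g /upd !IHn eqxx (eq_sym b a) (negPf ab) eqxx subnS.
  by case: (x == b); case: (x == a).
split; first by rewrite it eqxx r1x.
by move=> x /negPf xa /negPf xb; rewrite it xa xb r1x ?xb.
Qed.

Definition copy a b c :=
  Seq (clear b) (Seq (clear c)
    (Seq (While a (Seq (Dec a) (Seq (Inc b) (Inc c)))) (transfer c a))).

Lemma copyP a b c r : a != b -> a != c -> b != c ->
  exists2 r', bigstep (copy a b c) r r' &
  r' b = r a /\ forall x, x != b -> x != c -> r' x = r x.
Proof.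
move=> ab ac bc; have [r1 b1 [r1b r1x]] := clearP b r.
have [r2 b2 [r2c r2x]] := clearP c r1.
pose g1 r := upd r a (r a).-1.
pose g2 r := upd (g1 r) b (g1 r b).+1.
pose g r := upd (g2 r) c (g2 r c).+1.
have b3 : bigstep (While a (Seq (Dec a) (Seq (Inc b) (Inc c)))) r2 (iter (r2 a) g r2).
  apply: bigstep_iter => r3.
    by apply: BSeq (BDec _ _) _; apply: BSeq (BInc _ _) (BInc _ _).
  by rewrite /g /g2 /g1 /upd (negPf ab) (negPf ac) eqxx.
have it n x : iter n g r2 x =
    if x == c then n else if x == b then n else if x == a then r2 a - n else r2 x.
  elim: n x => [|n IHn] x /=.
    by rewrite subn0; case: (x =P c) => [->//|_]; case: (x =P b) => [->|_]; [by rewrite r2x // r1b | by case: (x =P a) => [->|]].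
  rewrite /g /g2 /g1 /upd !IHn !eqxx (eq_sym b a) (eq_sym c a) (eq_sym c b).
  rewrite (negPf ab) (negPf ac) (negPf bc) subnS.
  by case: (x == c); case: (x == b); case: (x == a).
have [|r4 b4 [r4a r4x]] := @transferP c a (iter (r2 a) g r2); first by rewrite eq_sym.
exists r4; first by do 3![apply: BSeq; eauto].
have ba : b != a by rewrite eq_sym.
split; first by rewrite (r4x b bc ba) it (negPf bc) eqxx r2x // r1x.
move=> x xb xc; case: (eqVneq x a) => [->|xa].
  by rewrite r4a it eqxx r2x // r1x.
by rewrite r4x // it (negPf xa) (negPf xb) (negPf xc) r2x // r1x.
Qed.

(** * Primitive recursive terms and their compilation *)

Inductive tm :=
| Var of nat
| Zero
| Succ of tm
| Comp of tm & tm
| Rec of tm & tm & tm.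

Fixpoint eval t (e : seq nat) : nat :=
  match t with
  | Var i => nth 0 e i
  | Zero => 0
  | Succ t => (eval t e).+1
  | Comp t u => eval u [:: eval t e]
  | Rec n z s => iteri (eval n e) (fun i a => eval s [:: i, a & e]) (eval z e)
  end.

(* [rho] lists the registers of the variables, [d] receives the result and all
   the registers above [d] are scratch. *)
Fixpoint compile t (rho : seq nat) d : prog :=
  match t with
  | Var i => if i < size rho then copy (nth 0 rho i) d d.+1 else clear d
  | Zero => clear d
  | Succ t => Seq (compile t rho d) (Inc d)
  | Comp t u => Seq (compile t rho d.+1)
                    (Seq (compile u [:: d.+1] d.+2) (transfer d.+2 d))
  | Rec n z s =>
      Seq (compile z rho d) (Seq (compile n rho d.+1) (Seq (clear d.+2)
        (While d.+1 (Seq (Dec d.+1) (Seq (compile s [:: d.+2, d & rho] d.+3)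
          (Seq (transfer d.+3 d) (Inc d.+2)))))))
  end.

(** Induction on [t]. The frame clause on registers below [d] carries the induction: variables live
    there, and each intermediate result is protected by computing the next ones in higher
    registers. *)
Lemma compileP t rho d r : all (fun k => k < d) rho ->
  exists2 r', bigstep (compile t rho d) r r' &
  r' d = eval t (map r rho) /\ forall k, k < d -> r' k = r k.
Proof.
have lt_neq k m : k < m -> k != m by move=> km; rewrite neq_ltn km.
have frame rho1 d1 r1 r2 : all (fun k => k < d1) rho1 ->
    (forall k, k < d1 -> r1 k = r2 k) -> map r1 rho1 = map r2 rho1.
  by move=> /allP hrho r12; apply/eq_in_map => k /hrho; exact: r12.
have wider rho1 d1 d2 : d1 <= d2 -> all (fun k => k < d1) rho1 -> all (fun k => k < d2) rho1.
  by move=> d12; apply: sub_all => k kd; apply: leq_trans d12.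
elim: t rho d r => [i||t IHt|t IHt u IHu|n IHn z IHz s IHs] rho d r hrho /=.
- case: ltnP => hi.
    have /lt_neq xd : nth 0 rho i < d by apply: (allP hrho); exact: mem_nth.
    have xd1 : nth 0 rho i != d.+1.
      by apply: lt_neq; apply: ltnW; apply: (allP hrho); exact: mem_nth.
    have [|r' b' [e1 e2]] := @copyP (nth 0 rho i) d d.+1 r xd xd1.
      by apply: lt_neq.
    exists r' => //; split; first by rewrite e1 (nth_map 0).
    by move=> k kd; rewrite e2 // lt_neq // ltnW.
  have [r' b' [e1 e2]] := clearP d r.
  exists r' => //; split; first by rewrite e1 nth_default // size_map.
  by move=> k kd; rewrite e2 // lt_neq.
- have [r' b' [e1 e2]] := clearP d r.
  by exists r' => //; split=> // k kd; rewrite e2 // lt_neq.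
- have [r1 b1 [e1 f1]] := IHt rho d r hrho.
  exists (upd r1 d (r1 d).+1); first by apply: BSeq b1 (BInc _ _).
  rewrite /upd eqxx e1; split=> // k kd.
  by rewrite (negPf (lt_neq _ _ kd)) f1.
- have [|r1 b1 [e1 f1]] := IHt rho d.+1 r; first exact: wider hrho.
  have [|r2 b2 [e2 f2]] := IHu [:: d.+1] d.+2 r1; first by rewrite /= ltnS leqnn.
  have [|r3 b3 [e3 f3]] := @transferP d.+2 d r2; first by lia.
  exists r3; first by do 2![apply: BSeq; eauto].
  split; first by rewrite e3 e2 /= e1.
  by move=> k kd; rewrite f3 ?f2 ?f1 //; lia.
- have [r1 b1 [e1 f1]] := IHz rho d r hrho.
  have [|r2 b2 [e2 f2]] := IHn rho d.+1 r1; first exact: wider hrho.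
  have [r3 b3 [e3 f3]] := clearP d.+2 r2.
  have er1 : map r1 rho = map r rho by apply: frame hrho _.
  set f := fun i a => eval s [:: i, a & map r rho].
  pose N := eval n (map r rho).
  (* Invariant with [m] rounds left: the number [N - m] of rounds done is kept in [d.+2], as first
     variable of [s], and the accumulator in [d]. *)
  pose I m (r' : nat -> nat) := [/\ m <= N, r' d.+2 = N - m,
    r' d = iteri (N - m) f (eval z (map r rho)) & forall k, k < d -> r' k = r k].
  have [m||r4 b4 [[_ _ e4 f4] _]] := @runs_while d.+1
     (Seq (Dec d.+1) (Seq (compile s [:: d.+2, d & rho] d.+3)
          (Seq (transfer d.+3 d) (Inc d.+2)))) I _ N r3 _; first 1 last.
  + split; last by rewrite f3 ?e2 ?er1 //; lia.
    by rewrite /I subnn /=; split=> // [|k kd]; rewrite f3 ?f2 ?e1 ?f1 //; lia.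
  + exists r4; first by do 3![apply: BSeq; eauto].
    by rewrite subn0 in e4.
  move=> q [[mN q2 qd fq] q1].
  pose q' := upd q d.+1 (q d.+1).-1.
  have [|r4 b4 [e4 f4]] := IHs [:: d.+2, d & rho] d.+3 q'.
    by rewrite /= !ltnS leqnn leqW //=; apply: wider hrho; lia.
  have [|r5 b5 [e5 f5]] := @transferP d.+3 d r4; first by lia.
  pose q6 := upd r5 d.+2 (r5 d.+2).+1.
  have q62 : q6 d.+2 = (r5 d.+2).+1 by rewrite /q6 /upd eqxx.
  have q6x k : k != d.+2 -> q6 k = r5 k by rewrite /q6 /upd => /negPf->.
  exists q6; first by apply: BSeq (BDec _ _) _; apply: BSeq b4 _; apply: BSeq b5 (BInc _ _).
  have q'x k : k != d.+1 -> q' k = q k by rewrite /q' /upd => /negPf->.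
  split; last by rewrite q6x ?f5 ?f4 /q' /upd ?eqxx ?q1 //; lia.
  split; first by lia.
  + by rewrite q62 f5 ?f4 ?q'x ?q2; lia.
  + rewrite q6x ?e5 ?e4 /= ?q'x ?q2 ?qd; try lia.
    rewrite (_ : map q' rho = map r rho); last first.
      by apply: frame hrho _ => k kd; rewrite q'x ?fq //; lia.
    by rewrite -(subnSK mN).
  + by move=> k kd; rewrite q6x ?f5 ?f4 ?q'x ?fq //; lia.
Qed.

(** Register 0 keeps the input, register 1 the candidate and register 2 the value of [g], set to 1
    beforehand so that the loop is entered. The body increments the candidate even after the
    successful test, hence the decrement before [a] is evaluated. *)
Lemma search_program (g a : tm) : exists P, forall n,
  (exists z, eval g [:: z; n] = 0) ->
  exists2 z, eval g [:: z; n] = 0 &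
  exists t, let c := iter t (cm_step P) (cm_init n) in
    size P <= c.1 /\ c.2 0 = eval a [:: z; n].
Proof.
pose body := Seq (compile g [:: 1; 0] 2) (Inc 1).
pose p := Seq (Inc 2) (Seq (While 2 body)
  (Seq (Dec 1) (Seq (compile a [:: 1; 0] 2) (transfer 2 0)))).
exists (assemble p 0) => n [z0 gz0].
(* Induction on the distance [m] to a known zero of [g]; the loop may stop at an earlier zero. *)
have loop m : forall z r, r 0 = n -> r 1 = z -> r 2 != 0 -> eval g [:: z + m; n] = 0 ->
    exists2 r', bigstep (While 2 body) r r' &
    r' 0 = n /\ exists2 z', r' 1 = z'.+1 & eval g [:: z'; n] = 0.
  elim: m => [|m IHm] z r r0 r1 r2 gz.
    have [//|q b [q2 qx]] := @compileP g [:: 1; 0] 2 r.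
    exists (upd q 1 (q 1).+1); last first.
      rewrite /upd /= !qx // r0 r1; split=> //; exists z => //; by rewrite addn0 in gz.
    apply: BWhileS r2 (BSeq b (BInc _ _)) (BWhile0 _ _).
    by rewrite /upd /= q2 /= r0 r1; rewrite addn0 in gz.
  have [//|q b [q2 qx]] := @compileP g [:: 1; 0] 2 r.
  pose q' := upd q 1 (q 1).+1.
  have b' : bigstep body r q' by apply: BSeq b (BInc _ _).
  rewrite /= r0 r1 in q2.
  case: (eqVneq (eval g [:: z; n]) 0) => [gz0'|gn0].
    exists q'; last by rewrite /q' /upd /= !qx // r0 r1; split=> //; exists z.
    by apply: BWhileS r2 b' (BWhile0 _ _); rewrite /q' /upd /= q2.
  have [||||q1 b1 q1P] := IHm z.+1 q'.
  - by rewrite /q' /upd /= qx.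
  - by rewrite /q' /upd /= qx // r1.
  - by rewrite /q' /upd [_ == _]/= q2.
  - by rewrite addSnnS.
  by exists q1 => //; apply: BWhileS r2 b' b1.
pose i0 := fun x : nat => if x == 0 then n else 0.
have [r1 b1 [r10 [z r11 gz]]] := loop z0 0 (upd i0 2 1) erefl erefl isT gz0.
exists z => //; pose r2 := upd r1 1 z.
have [//|r3 b3 [r32 r3x]] := @compileP a [:: 1; 0] 2 r2.
have [//|r4 b4 [r40 _]] := @transferP 2 0 r3.
have bp : bigstep p i0 r4.
  apply: BSeq (BInc _ _) _; apply: BSeq b1 _.
  have := BDec 1 r1; rewrite r11 => bd; apply: BSeq bd _.
  exact: BSeq b3 b4.
have [|||t [m [tm [_ sm]]]] := @assembleP _ _ _ bp (assemble p 0) 0 [::] [::] i0.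
- by rewrite /= cats0.
- by [].
- by split=> // -[|k].
exists t; rewrite /cm_init -/i0 tm; split; first by rewrite size_assemble.
by rewrite -[_.2 0]/(m (reg 0)) sm r40 r32 /= /r2 /upd /= r10.
Qed.

(** * Primitive recursive functions *)

Definition tAdd a b := Rec a b (Succ (Var 1)).
Definition tPred a := Rec a Zero (Var 0).
Definition tSub a b := Rec b a (tPred (Var 1)).
Definition tDouble a := tAdd a a.
Definition tNot a := tSub (Succ Zero) a.
Definition tOdd a := Rec a Zero (tNot (Var 1)).
Definition tHalf a := Rec a Zero (tAdd (tOdd (Var 0)) (Var 1)).
Definition tCons a b := Rec a (Succ (tDouble b)) (tDouble (Var 1)).
Definition tShift a b := Rec b a (tHalf (Var 1)).
Definition tHead a := Comp a (Rec (Var 0) Zero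
  (tAdd (tNot (tOdd (tShift (Var 2) (Var 1)))) (Var 1))).
Definition tTail a := Comp a (tShift (Var 0) (Succ (tHead (Var 0)))).

Fixpoint tConst n := if n is n'.+1 then Succ (tConst n') else Zero.

Lemma eval_const n e : eval (tConst n) e = n.
Proof. by elim: n => //= n ->. Qed.

Lemma eval_add a b e : eval (tAdd a b) e = eval a e + eval b e.
Proof. by rewrite /=; elim: (eval a e) => //= n ->. Qed.

Lemma iteri_iter T n (f : T -> T) z : iteri n (fun _ => f) z = iter n f z.
Proof. by elim: n => //= n ->. Qed.

Lemma eval_sub a b e : eval (tSub a b) e = eval a e - eval b e.
Proof.
rewrite [LHS]/=; elim: (eval b e) => [|n IHn]; first by rewrite subn0.
by rewrite [LHS]/= IHn subnS; case: (_ - _).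
Qed.

Lemma eval_not a e : eval (tNot a) e = (eval a e == 0).
Proof. by rewrite eval_sub [eval (Succ _) _]/=; case: (eval a e). Qed.

Lemma eval_odd a e : eval (tOdd a) e = odd (eval a e).
Proof.
have -> : eval (tOdd a) e =
    iteri (eval a e) (fun i x => eval (tNot (Var 1)) [:: i, x & e]) 0 by [].
elim: (eval a e) => // n IHn; rewrite iteriS IHn.
by rewrite eval_not /=; case: odd.
Qed.

Lemma eval_half a e : eval (tHalf a) e = (eval a e)./2.
Proof.
have -> : eval (tHalf a) e =
    iteri (eval a e) (fun i x => eval (tAdd (tOdd (Var 0)) (Var 1)) [:: i, x & e]) 0 by [].
elim: (eval a e) => // n IHn; rewrite iteriS IHn.
by rewrite eval_add eval_odd /= uphalf_half.
Qed.

(** The list constructor on [pickle] codes: [h] is the 2-adic valuation of the result, and [t] is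
    half of its odd part, rounded down. *)
Definition consn h t := 2 ^ h * t.*2.+1.
(** The counter advances as long as [n] halved that many times is even, so it stops at the 2-adic
    valuation; [n] rounds are enough, the valuation of a positive [n] being less than [n]. *)
Definition headn n := iter n (fun k => ~~ odd (iter k half n) + k) 0.
Definition tailn n := iter (headn n).+1 half n.

Lemma eval_cons a b e : eval (tCons a b) e = consn (eval a e) (eval b e).
Proof.
rewrite /consn.
have -> : eval (tCons a b) e = iteri (eval a e)
  (fun i x => eval (tDouble (Var 1)) [:: i, x & e]) (eval (tDouble b) e).+1 by [].
rewrite /tDouble eval_add addnn; elim: (eval a e) => [|n IHn]; first by rewrite mul1n.
by rewrite iteriS IHn eval_add [eval _ _]/= expnS -mulnA mul2n addnn.
Qed.

Lemma eval_shift a b e : eval (tShift a b) e = iter (eval b e) half (eval a e).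
Proof.
have -> : eval (tShift a b) e = iteri (eval b e)
  (fun i x => eval (tHalf (Var 1)) [:: i, x & e]) (eval a e) by [].
rewrite -iteri_iter; elim: (eval b e) => // n IHn.
by rewrite iteriS IHn eval_half.
Qed.

Lemma eval_head a e : eval (tHead a) e = headn (eval a e).
Proof.
rewrite /headn; set n := eval a e.
have -> : eval (tHead a) e = iteri n (fun i x =>
   eval (tAdd (tNot (tOdd (tShift (Var 2) (Var 1)))) (Var 1)) [:: i; x; n]) 0 by [].
elim: {1 3}n => // k IHk; rewrite iteriS IHk.
by rewrite eval_add eval_not eval_odd eval_shift /=; case: odd.
Qed.

Lemma eval_tail a e : eval (tTail a) e = tailn (eval a e).
Proof.
have -> : eval (tTail a) e = eval (tShift (Var 0) (Succ (tHead (Var 0)))) [:: eval a e] by [].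
rewrite eval_shift -[eval (Succ _) _]/(eval (tHead (Var 0)) [:: eval a e]).+1.
by rewrite eval_head.
Qed.

Lemma eval_comp t u e : eval (Comp t u) e = eval u [:: eval t e].
Proof. by []. Qed.

Definition tPair a b := tCons a (tCons b Zero).

Lemma eval_pair a b e :
  eval (tPair a b) e = consn (eval a e) (consn (eval b e) 0).
Proof. by rewrite !eval_cons. Qed.

Lemma half_consn h t k : k <= h -> iter k half (consn h t) = consn (h - k) t.
Proof.
elim: k => [|k IHk] kh; first by rewrite subn0.
rewrite iterS IHk ?(ltnW kh) // -(subnSK kh) /consn expnS -mulnA mul2n.
by rewrite doubleK.
Qed.

Lemma headn_consn h t : headn (consn h t) = h.
Proof.
rewrite /headn; set n := consn h t.
have hn : h <= n by rewrite /n /consn (leq_trans (ltnW (ltn_expl h (ltnSn 1)))) ?leq_pmulr.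
have it k : iter k (fun k => ~~ odd (iter k half n) + k) 0 = minn k h.
  elim: k => [|k IHk]; first by rewrite min0n.
  rewrite iterS IHk; case: (ltnP k h) => kh.
    rewrite (minn_idPl kh) half_consn ?(ltnW kh) //.
    by rewrite -(subnSK kh) /consn expnS -mulnA mul2n odd_double.
  rewrite (minn_idPr (leqW kh)) half_consn // subnn /consn.
  by rewrite mul1n /= odd_double.
by rewrite it (minn_idPr hn).
Qed.

Lemma tailn_consn h t : tailn (consn h t) = t.
Proof.
by rewrite /tailn headn_consn iterS half_consn // subnn /consn mul1n /= uphalf_double.
Qed.

Lemma consn_gt0 h t : 0 < consn h t.
Proof. by rewrite /consn muln_gt0 expn_gt0. Qed.

Lemma pickle_cons (A : countType) (x : A) s : pickle (x :: s) = consn (pickle x) (pickle s).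
Proof. by []. Qed.

Lemma pickle_pair (A B : countType) (x : A) (y : B) :
  pickle (x, y) = consn (pickle x) (consn (pickle y) 0).
Proof. by []. Qed.

(** * Functions between countable types that are primitive recursive on codes *)

Definition computable (E A : countType) (f : E -> A) :=
  exists t, forall e, eval t [:: pickle e] = pickle (f e).

Section Computable.

Implicit Types E A B C D : countType.

Lemma computable_comp E A B (g : A -> B) (f : E -> A) :
  computable g -> computable f -> computable (fun e => g (f e)).
Proof. by move=> [t ht] [u hu]; exists (Comp u t) => e /=; rewrite hu ht. Qed.

Lemma computable_id E : computable (fun e : E => e).
Proof. by exists (Var 0). Qed.

Lemma computable_const E A (c : A) : computable (fun _ : E => c).
Proof. by exists (tConst (pickle c)) => e; rewrite eval_const. Qed.

Lemma computable_fst E A B (f : E -> A * B) : computable f -> computable (fun e => (f e).1).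
Proof.
move=> [t ht]; exists (tHead t) => e; rewrite eval_head ht.
by case: (f e) => a b; rewrite pickle_pair headn_consn.
Qed.

Lemma computable_snd E A B (f : E -> A * B) : computable f -> computable (fun e => (f e).2).
Proof.
move=> [t ht]; exists (tHead (tTail t)) => e; rewrite eval_head eval_tail ht.
by case: (f e) => a b; rewrite pickle_pair tailn_consn headn_consn.
Qed.

Lemma computable_pair E A B (f : E -> A) (g : E -> B) :
  computable f -> computable g -> computable (fun e => (f e, g e)).
Proof.
move=> [t ht] [u hu]; exists (tPair t u) => e.
by rewrite eval_pair ht hu.
Qed.

Lemma computable_comp2 E A B C (h : A -> B -> C) (f : E -> A) (g : E -> B) :
  computable (fun x : A * B => h x.1 x.2) ->
  computable f -> computable g -> computable (fun e => h (f e) (g e)).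
Proof.
move=> hh hf hg.
exact: (computable_comp (f := fun e => (f e, g e)) hh (computable_pair hf hg)).
Qed.

Lemma computable_code E A (f : E -> A) :
  computable f -> computable (fun e => pickle (f e)).
Proof. by move=> [t ht]; exists t. Qed.

Lemma computable_succ E (f : E -> nat) : computable f -> computable (fun e => (f e).+1).
Proof. by move=> [t ht]; exists (Succ t) => e /=; rewrite ht. Qed.

Lemma computable_add E (f g : E -> nat) :
  computable f -> computable g -> computable (fun e => f e + g e).
Proof. by move=> [t ht] [u hu]; exists (tAdd t u) => e; rewrite eval_add ht hu. Qed.

Lemma computable_sub E (f g : E -> nat) :
  computable f -> computable g -> computable (fun e => f e - g e).
Proof. by move=> [t ht] [u hu]; exists (tSub t u) => e; rewrite eval_sub ht hu. Qed.

Lemma computable_eq E A (f g : E -> A) :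
  computable f -> computable g -> computable (fun e => f e == g e).
Proof.
move=> [t ht] [u hu]; exists (tNot (tAdd (tSub t u) (tSub u t))) => e.
rewrite eval_not eval_add !eval_sub ht hu addn_eq0 !subn_eq0 -eqn_leq.
by rewrite (inj_eq (pcan_inj pickleK)).
Qed.

Lemma computable_if E A (b : E -> bool) (f g : E -> A) :
  computable b -> computable f -> computable g ->
  computable (fun e => if b e then f e else g e).
Proof.
(* A boolean has code 0 or 1, so recursion on it runs the step zero times or once; inside the step,
   [Var 2] is the original argument. *)
move=> [t ht] [u hu] [v hv]; exists (Rec t v (Comp (Var 2) u)) => e /=.
by rewrite ht hv hu; case: (b e).
Qed.

Lemma computable_neg E (b : E -> bool) : computable b -> computable (fun e => ~~ b e).
Proof. by move=> hb; apply: computable_if => //; apply: computable_const. Qed.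

Lemma computable_and E (b c : E -> bool) :
  computable b -> computable c -> computable (fun e => b e && c e).
Proof. by move=> hb hc; apply: computable_if => //; apply: computable_const. Qed.

Lemma computable_or E (b c : E -> bool) :
  computable b -> computable c -> computable (fun e => b e || c e).
Proof. by move=> hb hc; apply: computable_if => //; apply: computable_const. Qed.

Lemma computable_iteri E A (n : E -> nat) (f : E -> nat -> A -> A) (z : E -> A) :
  computable n -> computable (fun x : E * nat * A => f x.1.1 x.1.2 x.2) -> computable z ->
  computable (fun e => iteri (n e) (f e) (z e)).
Proof.
move=> [t ht] [u hu] [v hv].
exists (Rec t v (Comp (tPair (tPair (Var 2) (Var 0)) (Var 1)) u)) => e.
have -> : forall tn tz p e', eval (Rec tn tz (Comp p u)) e' =
  iteri (eval tn e') (fun i a => eval u [:: eval p [:: i, a & e']]) (eval tz e') by [].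
rewrite ht hv; move: (n e : nat) => k; rewrite [pickle k]/=; elim: k => // k IHk.
by rewrite !iteriS IHk -(hu (e, k, _)) !eval_pair.
Qed.

Lemma computable_iter E A (n : E -> nat) (f : E -> A -> A) (z : E -> A) :
  computable n -> computable (fun x : E * A => f x.1 x.2) -> computable z ->
  computable (fun e => iter (n e) (f e) (z e)).
Proof.
move=> hn hf hz.
have [|t ht] := @computable_iteri E A n (fun e _ => f e) z hn _ hz.
  apply: (computable_comp (g := fun x : E * A => f x.1 x.2) (f := fun x => (x.1.1, x.2)) hf).
  by apply: computable_pair; do ?apply: computable_fst; do ?apply: computable_snd; exact: computable_id.
by exists t => e; rewrite ht iteri_iter.
Qed.

Lemma computable_cons E A (f : E -> A) (s : E -> seq A) :
  computable f -> computable s -> computable (fun e => f e :: s e).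
Proof. by move=> [t ht] [u hu]; exists (tCons t u) => e; rewrite eval_cons ht hu. Qed.

(** Lets the code of a list serve as the number of rounds of a recursion along that list. *)
Lemma size_le_code A (s : seq A) : size s <= pickle s.
Proof.
elim: s => // x s IHs; rewrite pickle_cons /= (leq_ltn_trans IHs) // /consn.
by rewrite (@leq_trans (pickle s).*2.+1) ?leq_pmull ?expn_gt0 // ltnS -addnn leq_addr.
Qed.

Lemma tailn_code A (s : seq A) : tailn (pickle s) = pickle (behead s).
Proof. by case: s => // x s; rewrite pickle_cons tailn_consn. Qed.

Lemma computable_foldl E A B (f : E -> B -> A -> B) (z : E -> B) (s : E -> seq A) :
  computable (fun x : E * B * A => f x.1.1 x.1.2 x.2) -> computable z -> computable s ->
  computable (fun e => foldl (f e) (z e) (s e)).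
Proof.
move=> [u hu] [v hv] [t ht].
(* [rest k] drops from the list as many entries as variable [k] says, the input being variable
   [k.+2]. In [step], recursion on this code acts as a conditional, because its body ignores the
   previous value: code 0 leaves the accumulator alone, any other code gives [f] applied to the
   first remaining entry. *)
pose rest k := Rec (Var k) (Comp (Var k.+2) t) (tTail (Var 1)).
pose step := Rec (rest 0) (Var 1) (Comp (tPair (tPair (Var 4) (Var 3)) (tHead (rest 2))) u).
have restP k e i env : nth 0 env k = i -> nth 0 env k.+2 = pickle e ->
    eval (rest k) env = pickle (drop i (s e)).
  move=> ei ee; have -> : eval (rest k) env =
    iteri (nth 0 env k) (fun i a => eval (tTail (Var 1)) [:: i, a & env])
       (eval t [:: nth 0 env k.+2]) by [].
  rewrite ei ee ht; elim: i {ei} => [|i IHi]; first by rewrite drop0.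
  by rewrite iteriS IHi eval_tail /= tailn_code drop_behead -iterS -drop_behead.
exists (Rec t v step) => e.
have -> : eval (Rec t v step) [:: pickle e] =
  iteri (eval t [:: pickle e]) (fun i a => eval step [:: i; a; pickle e])
    (eval v [:: pickle e]) by [].
rewrite ht hv -{2}(take_oversize (size_le_code (s e))).
elim: (pickle (s e)) => [|k IHk]; first by rewrite take0.
rewrite iteriS IHk.
have -> env : eval step env = iteri (eval (rest 0) env)
  (fun i a => eval (Comp (tPair (tPair (Var 4) (Var 3)) (tHead (rest 2))) u) [:: i, a & env])
  (nth 0 env 1) by [].
rewrite (restP 0 e k) //.
case: (ltnP k (size (s e))) => hk; last first.
  by rewrite drop_oversize // !take_oversize // (leq_trans hk).
case ds: (drop k (s e)) => [|x s']; first by move: (congr1 size ds); rewrite size_drop /=; lia.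
rewrite (_ : take k.+1 (s e) = rcons (take k (s e)) x); last first.
  by rewrite -addn1 takeD ds /= take0 cats1.
rewrite foldl_rcons -(hu (e, _, x)) pickle_cons.
have := consn_gt0 (pickle x) (pickle s'); case: (consn _ _) (erefl (consn (pickle x) (pickle s'))) => // n en _.
rewrite iteriS eval_comp !eval_pair eval_head (restP 2 e k) // ds pickle_cons.
by rewrite headn_consn.
Qed.

Lemma computable_comp3 E A B C D (h : A -> B -> C -> D) (f : E -> A) (g : E -> B) (k : E -> C) :
  computable (fun x : A * B * C => h x.1.1 x.1.2 x.2) ->
  computable f -> computable g -> computable k ->
  computable (fun e => h (f e) (g e) (k e)).
Proof.
move=> hh hf hg hk; exact: (computable_comp (f := fun e => (f e, g e, k e)) hh
  (computable_pair (computable_pair hf hg) hk)).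
Qed.

End Computable.

Ltac computable_step :=
  match goal with
  | |- _ => assumption
  | |- computable (fun x => x) => apply: computable_id
  | |- computable (fun x => ?c) => apply: (computable_const _ c)
  | |- computable (fun x => fst (@?f x)) => apply: (computable_fst (f := f))
  | |- computable (@fst _ _) => apply: (computable_fst (f := fun x => x))
  | |- computable (@snd _ _) => apply: (computable_snd (f := fun x => x))
  | |- computable (fun x => snd (@?f x)) => apply: (computable_snd (f := f))
  | |- computable (fun x => pair (@?f x) (@?g x)) => apply: (computable_pair (f := f) (g := g))
  | |- computable (fun x => @?f x :: @?g x) => apply: (computable_cons (f := f) (s := g))
  | |- computable (fun x => S (@?f x)) => apply: (computable_succ (f := f))
  | |- computable (fun x => @?f x + @?g x) => apply: (computable_add (f := f) (g := g))
  | |- computable (fun x => @?f x - @?g x) => apply: (computable_sub (f := f) (g := g))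
  | |- computable (fun x => @?f x == @?g x) => apply: (computable_eq (f := f) (g := g))
  | |- computable (fun x => ~~ @?f x) => apply: (computable_neg (b := f))
  | |- computable (fun x => @?f x && @?g x) => apply: (computable_and (b := f) (c := g))
  | |- computable (fun x => @?f x || @?g x) => apply: (computable_or (b := f) (c := g))
  end.

Ltac computable := repeat computable_step.

(** * Computability of operations on lists *)

Section ComputableSeq.

Implicit Types E A B : countType.

Lemma computable_ext E A (f g : E -> A) : computable f -> f =1 g -> computable g.
Proof. by move=> [t ht] fg; exists t => e; rewrite ht fg. Qed.

Lemma computable_rev E A (s : E -> seq A) : computable s -> computable (fun e => rev (s e)).
Proof.
move=> hs; apply: (@computable_ext _ _ (fun e => foldl (fun b a => a :: b) [::] (s e))).
  by apply: (@computable_foldl _ _ _ (fun _ b a => a :: b)); computable.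
move=> e; rewrite -[rev _]cats0; elim: (s e) [::] => // x s' IHs b /=.
by rewrite IHs rev_cons cat_rcons.
Qed.

Lemma computable_foldr E A B (f : E -> A -> B -> B) (z : E -> B) (s : E -> seq A) :
  computable (fun x : E * A * B => f x.1.1 x.1.2 x.2) -> computable z -> computable s ->
  computable (fun e => foldr (f e) (z e) (s e)).
Proof.
move=> hf hz hs.
apply: (@computable_ext _ _ (fun e => foldl (fun b a => f e a b) (z e) (rev (s e)))).
  apply: (@computable_foldl _ _ _ (fun e b a => f e a b)) => //; last exact: computable_rev.
  by apply: (computable_comp3 (h := f)); computable.
by move=> e; rewrite foldl_rev.
Qed.

Lemma computable_map E A B (f : E -> A -> B) (s : E -> seq A) :
  computable (fun x : E * A => f x.1 x.2) -> computable s ->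
  computable (fun e => map (f e) (s e)).
Proof.
move=> hf hs; apply: (@computable_foldr _ _ _ (fun e a b => f e a :: b) (fun=> [::])).
- by computable; apply: (computable_comp2 (h := f)); computable.
- by computable.
- by [].
Qed.

Lemma computable_cat E A (s t : E -> seq A) :
  computable s -> computable t -> computable (fun e => s e ++ t e).
Proof.
move=> hs ht; apply: (@computable_ext _ _ (fun e => foldr (fun a b => a :: b) (t e) (s e))).
  by apply: (@computable_foldr _ _ _ (fun _ a b => a :: b)); computable.
by move=> e; elim: (s e) => //= x s' ->.
Qed.

Lemma computable_filter E A (p : E -> A -> bool) (s : E -> seq A) :
  computable (fun x : E * A => p x.1 x.2) -> computable s ->
  computable (fun e => filter (p e) (s e)).
Proof.
move=> hp hs.
apply: (@computable_ext _ _ (fun e => foldr (fun a b => if p e a then a :: b else b) [::] (s e))).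
  apply: (@computable_foldr _ _ _ (fun e a b => if p e a then a :: b else b)); computable.
  apply: computable_if; computable.
  by apply: (computable_comp2 (h := p)); computable.
by move=> e; elim: (s e) => //= x s' ->.
Qed.

Lemma computable_flatten E A (s : E -> seq (seq A)) :
  computable s -> computable (fun e => flatten (s e)).
Proof.
move=> hs; apply: (@computable_foldr _ _ _ (fun _ => cat)); computable.
by apply: computable_cat; computable.
Qed.

Lemma computable_has E A (p : E -> A -> bool) (s : E -> seq A) :
  computable (fun x : E * A => p x.1 x.2) -> computable s ->
  computable (fun e => has (p e) (s e)).
Proof.
move=> hp hs; apply: (@computable_foldr _ _ _ (fun e a b => p e a || b) (fun=> false)); computable.
by apply: (computable_comp2 (h := p)); computable.
Qed.

Lemma computable_all E A (p : E -> A -> bool) (s : E -> seq A) :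
  computable (fun x : E * A => p x.1 x.2) -> computable s ->
  computable (fun e => all (p e) (s e)).
Proof.
move=> hp hs; apply: (@computable_foldr _ _ _ (fun e a b => p e a && b) (fun=> true)); computable.
by apply: (computable_comp2 (h := p)); computable.
Qed.

Lemma computable_mem E A (x : E -> A) (s : E -> seq A) :
  computable x -> computable s -> computable (fun e => x e \in s e).
Proof.
move=> hx hs; apply: (@computable_ext _ _ (fun e => has (fun y => y == x e) (s e))).
  apply: (@computable_has _ _ (fun e y => y == x e)) => //; computable.
  by apply: (computable_comp (g := x)); computable.
by move=> e; rewrite -has_pred1.
Qed.

Lemma computable_size E A (s : E -> seq A) : computable s -> computable (fun e => size (s e)).
Proof.
move=> hs; apply: (@computable_ext _ _ (fun e => foldr (fun _ n => n.+1) 0 (s e))).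
  by apply: (@computable_foldr _ _ _ (fun _ _ n => n.+1)); computable.
by move=> e; elim: (s e) => //= x s' ->.
Qed.

Lemma computable_iota E (n : E -> nat) : computable n -> computable (fun e => iota 0 (n e)).
Proof.
move=> hn; apply: (@computable_ext _ _
    (fun e => iteri (n e) (fun i s => s ++ [:: i]) [::])).
  apply: (@computable_iteri _ _ _ (fun _ i s => s ++ [:: i])); computable.
  by apply: computable_cat; computable.
by move=> e; elim: (n e) => // k IHk; rewrite iteriS IHk -addn1 iotaD.
Qed.

Lemma computable_drop E A (n : E -> nat) (s : E -> seq A) :
  computable n -> computable s -> computable (fun e => drop (n e) (s e)).
Proof.
move=> hn hs; apply: (@computable_ext _ _ (fun e => iter (n e) behead (s e))).
  apply: (@computable_iter _ _ _ (fun _ => behead)) => //; exists (tTail (tHead (tTail (Var 0)))).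
  by move=> [e x]; rewrite eval_tail eval_head eval_tail /= pickle_pair tailn_consn headn_consn tailn_code.
by move=> e; rewrite drop_behead.
Qed.

Lemma computable_take E A (n : E -> nat) (s : E -> seq A) :
  computable n -> computable s -> computable (fun e => take (n e) (s e)).
Proof.
move=> hn hs.
apply: (@computable_ext _ _ (fun e => rev (drop (size (s e) - n e) (rev (s e))))).
  apply: computable_rev; apply: computable_drop; last exact: computable_rev.
  by apply: computable_sub => //; exact: computable_size.
move=> e; rewrite drop_rev revK; case: (leqP (n e) (size (s e))) => h.
  by rewrite subKn.
by rewrite (take_oversize (ltnW h)) (eqP (ltnW h)) subn0 take_size.
Qed.

Lemma computable_nth E A (x0 : A) (n : E -> nat) (s : E -> seq A) :
  computable n -> computable s -> computable (fun e => nth x0 (s e) (n e)).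
Proof.
move=> hn hs.
apply: (@computable_ext _ _ (fun e => foldr (fun a _ => a) x0 (drop (n e) (s e)))).
  by apply: (@computable_foldr _ _ _ (fun _ a _ => a)); computable; exact: computable_drop.
by move=> e; rewrite -[n e in RHS]addn0 -nth_drop; case: drop.
Qed.

End ComputableSeq.

Ltac computable_seq_step :=
  match goal with
  | |- _ => computable_step
  | |- computable (fun x => pickle (@?f x)) => apply: (computable_code (f := f))
  | |- computable (fun x => @?f x ++ @?g x) => apply: (computable_cat (s := f) (t := g))
  | |- computable (fun x => flatten (@?f x)) => apply: (computable_flatten (s := f))
  | |- computable (fun x => size (@?f x)) => apply: (computable_size (s := f))
  | |- computable (fun x => iota 0 (@?f x)) => apply: (computable_iota (n := f))
  | |- computable (fun x => drop (@?f x) (@?g x)) => apply: (computable_drop (n := f) (s := g))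
  | |- computable (fun x => take (@?f x) (@?g x)) => apply: (computable_take (n := f) (s := g))
  | |- computable (fun x => nth ?d (@?g x) (@?f x)) =>
      apply: (computable_nth d (n := f) (s := g))
  | |- computable (fun x => iter (@?n x) (@?f x) (@?z x)) =>
      apply: (computable_iter (n := n) (f := f) (z := z))
  | |- computable (fun x => foldl (@?f x) (@?z x) (@?s x)) =>
      apply: (computable_foldl (f := f) (z := z) (s := s))
  | |- computable (fun x => foldr (@?f x) (@?z x) (@?s x)) =>
      apply: (computable_foldr (f := f) (z := z) (s := s))
  | |- computable (fun x => map (@?f x) (@?s x)) =>
      apply: (computable_map (f := f) (s := s))
  | |- computable (fun x => filter (@?f x) (@?s x)) =>
      apply: (computable_filter (p := f) (s := s))
  | |- computable (fun x => has (@?f x) (@?s x)) =>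
      apply: (computable_has (p := f) (s := s))
  | |- computable (fun x => all (@?f x) (@?s x)) =>
      apply: (computable_all (p := f) (s := s))
  | |- computable (fun x => in_mem (@?f x) (mem (@?s x))) =>
      apply: (computable_mem (x := f) (s := s))
  end.

Ltac computable_seq := repeat computable_seq_step.

Lemma eval_curry (E A : countType) t (f : E * nat -> A) :
  (forall e, eval t [:: pickle e] = pickle (f e)) ->
  forall z x, eval (Comp (tPair (Var 1) (Var 0)) t) [:: z; pickle x] = pickle (f (x, z)).
Proof. by move=> ht z x; rewrite eval_comp eval_pair -ht pickle_pair. Qed.

(** * Checking certificates *)

Definition trans := (nat * action * nat)%type.
Definition aut := (nat * seq nat * seq nat * seq (nat * nat * nat))%type.
(** The type of [encode M Ls], built from countable types: [x.1.1.1.2] is the number of channels,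
    [x.1.2] the transition list, [x.2] the list of automata. *)
Definition input := (nat * nat * seq nat * seq trans * seq aut)%type.

Definition aut0 : aut := (0, [::], [::], [::]).

Definition sendw c (l : seq trans) : seq nat :=
  [seq t.1.2.2 | t <- l & (t.1.2.1.1 == c) && t.1.2.1.2].

Definition recvw c (l : seq trans) : seq nat :=
  [seq t.1.2.2 | t <- l & (t.1.2.1.1 == c) && ~~ t.1.2.1.2].

Definition aut_step (A : aut) (S : seq nat) (a : nat) : seq nat :=
  [seq t.2 | t <- A.2 & (t.1.1 \in S) && (t.1.2 == a)].

Definition aut_grow (A : aut) (S : seq nat) : seq nat :=
  S ++ [seq t.2 | t <- A.2 & t.1.1 \in S].

(* [u] extends to a word accepted by [A], provided [K] bounds the number of
   states: that many steps of [aut_grow] reach all reachable states. *)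
Definition live K (A : aut) u : bool :=
  has (fun q => q \in A.1.2) (iter K (aut_grow A) (foldl (aut_step A) A.1.1.2 u)).

Definition state_bound (x : input) : nat := foldr (fun A n => A.1.1.1 + n) 0 x.2.

(** The sources are the targets shifted by one place with the initial state 0 in front, so [l] is a
    path starting in the initial state. *)
Definition connected (l : seq trans) : bool :=
  [seq t.1.1 | t <- l] == take (size l) (0 :: [seq t.2 | t <- l]).

(* A channel is a queue, so a sequence of actions can be executed iff at each
   moment what was received is a prefix of what was sent. *)
Definition fifo_ok c (l : seq trans) : bool :=
  all (fun k => recvw c (take k l) == take (size (recvw c (take k l))) (sendw c (take k l)))
      (iota 0 (size l).+1).

(** A run is given by its transitions alone, and each channel is tested separately. Testing the
    whole word sent is enough for liveness, since prefixes of a live word are live. *)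
Definition fireable (x : input) (l : seq trans) : bool :=
  connected l &&
  all (fun c => live (state_bound x) (nth aut0 x.2 c) (sendw c l) && fifo_ok c l)
      (iota 0 x.1.1.1.2).

Definition words (n : nat) (d : seq trans) : seq (seq trans) :=
  iter n (fun L => flatten [seq [seq t :: l | l <- L] | t <- d]) [:: [::]].

Definition pump (k N : nat) (l : seq trans) : seq trans :=
  take k l ++ iter N (cat (drop k l)) [::].

Definition exhausted (x : input) n : bool :=
  all (fun l => ~~ fireable x l) (words n x.1.2).

(** The number of copies exceeds every number of automaton states, as the pumping lemma requires,
    and also [n], the length of [l], which bounds preperiod plus period of each word sent. *)
Definition pumpable (x : input) n : bool :=
  has (fun l => has (fun k => fireable x (pump k (state_bound x + n).+1 l)) (iota 0 n))
    (words n x.1.2).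

Lemma computable_sendw : computable (fun x : nat * seq trans => sendw x.1 x.2).
Proof. by rewrite /sendw; computable_seq. Qed.

Lemma computable_recvw : computable (fun x : nat * seq trans => recvw x.1 x.2).
Proof. by rewrite /recvw; computable_seq. Qed.

Lemma computable_live : computable (fun x : nat * aut * seq nat => live x.1.1 x.1.2 x.2).
Proof. by rewrite /live /aut_grow /aut_step; computable_seq. Qed.

Lemma computable_state_bound : computable state_bound.
Proof.
apply: (@computable_foldr _ _ _ (fun _ (A : aut) n => A.1.1.1 + n) (fun=> 0) (fun x : input => x.2)).
all: by computable_seq.
Qed.

Lemma computable_fifo_ok : computable (fun x : nat * seq trans => fifo_ok x.1 x.2).
Proof.
rewrite /fifo_ok; computable_seq.
- by apply: (computable_comp2 computable_recvw); computable_seq.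
- by apply: (computable_comp2 computable_recvw); computable_seq.
- by apply: (computable_comp2 computable_sendw); computable_seq.
Qed.

Lemma computable_fireable : computable (fun x : input * seq trans => fireable x.1 x.2).
Proof.
rewrite /fireable /connected; computable_seq.
- apply: (computable_comp3 computable_live); computable_seq.
    by apply: (computable_comp computable_state_bound); computable_seq.
  by apply: (computable_comp2 computable_sendw); computable_seq.
- by apply: (computable_comp2 computable_fifo_ok); computable_seq.
Qed.

Lemma computable_words : computable (fun x : nat * seq trans => words x.1 x.2).
Proof. by rewrite /words; computable_seq. Qed.

Lemma computable_exhausted : computable (fun x : input * nat => exhausted x.1 x.2).
Proof.
rewrite /exhausted; computable_seq; last by apply: (computable_comp2 computable_words); computable_seq.
by apply: (computable_comp2 computable_fireable); computable_seq.
Qed.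

Lemma computable_pumpable : computable (fun x : input * nat => pumpable x.1 x.2).
Proof.
rewrite /pumpable /pump; computable_seq; last by apply: (computable_comp2 computable_words); computable_seq.
apply: (computable_comp2 computable_fireable); computable_seq.
by apply: (computable_comp computable_state_bound); computable_seq.
Qed.

(** * Prefixes of regular languages *)

Definition aut_of (A : nfa) : aut := (nst A, ninit A, nfin A, ntrans A).

Fixpoint nfa_run (A : nfa) p u q : Prop :=
  match u with
  | [::] => p = q
  | a :: u' => exists2 p', (p, a, p') \in ntrans A & nfa_run A p' u' q
  end.

Lemma nfa_run_cat A p u v q :
  nfa_run A p (u ++ v) q <-> exists2 r, nfa_run A p u r & nfa_run A r v q.
Proof.
elim: u p => [|a u IHu] p /=.
  by split=> [?|[r ->]] //; exists p.
split=> [[p' hp /IHu[r hr hq]]|[r [p' hp hr] hq]].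
  by exists r => //; exists p'.
by exists p' => //; apply/IHu; exists r.
Qed.

Lemma acc_from_cat A p u v :
  acc_from A p (u ++ v) <-> exists2 r, nfa_run A p u r & acc_from A r v.
Proof.
elim: u p => [|a u IHu] p /=.
  by split=> [?|[r ->]] //; exists p.
split=> [[p' [hp /IHu[r hr hq]]]|[r [p' hp hr] hq]].
  by exists r => //; exists p'.
by exists p'; split=> //; apply/IHu; exists r.
Qed.

Definition prefix_lang (A : nfa) u := exists z, nfa_lang A (u ++ z).

Lemma prefix_langP A u :
  prefix_lang A u <-> exists p q z, [/\ p \in ninit A, nfa_run A p u q & acc_from A q z].
Proof.
split=> [[z [p hp /acc_from_cat[q hq hz]]]|[p [q [z [hp hq hz]]]]].
  by exists p, q, z.
by exists z, p => //; apply/acc_from_cat; exists q.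
Qed.

Lemma prefix_lang_cat A u v : prefix_lang A (u ++ v) -> prefix_lang A u.
Proof. by move=> [z hz]; exists (v ++ z); rewrite catA. Qed.

Lemma acc_from_fin A q z : acc_from A q z <-> exists2 f, nfa_run A q z f & f \in nfin A.
Proof. by rewrite -{1}[z]cats0 acc_from_cat. Qed.

Definition rep (T : Type) k (u v : seq T) := iter k (cat u) v.

Lemma rep_cat T n (u v v' : seq T) : rep n u v ++ v' = rep n u (v ++ v').
Proof. by elim: n => //= n IHn; rewrite -catA IHn. Qed.

Lemma rep_nil T n (u v : seq T) : rep n u v = rep n u [::] ++ v.
Proof. by rewrite rep_cat. Qed.

Lemma repD T m n (u v : seq T) : rep (m + n) u v = rep m u (rep n u v).
Proof. exact: iterD. Qed.

Section Live.

Variables (k : nat) (A : nfa).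
Hypothesis wfA : wf_nfa k A.

Lemma wf_init p : p \in ninit A -> p < nst A.
Proof. by case: wfA => /allP h _; exact: h. Qed.

Lemma wf_trans p a q : (p, a, q) \in ntrans A -> [/\ p < nst A, a < k & q < nst A].
Proof. by case: wfA => _ [_ /allP h] /h/and3P. Qed.

Lemma nfa_run_lt p u q : nfa_run A p u q -> p < nst A -> q < nst A.
Proof.
by elim: u p => [p <-|a u IHu p [p' /wf_trans[_ _ hp'] /IHu h] _] //; exact: h.
Qed.

Lemma acc_from_letters p u : acc_from A p u -> all (fun a => a < k) u.
Proof. by elim: u p => //= a u IHu p [p' [/wf_trans[_ -> _] /IHu]]. Qed.

Lemma mem_aut_step S a q :
  reflect (exists2 p, p \in S & (p, a, q) \in ntrans A) (q \in aut_step (aut_of A) S a).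
Proof.
apply: (iffP mapP) => [[[[p b] q'] /=]|[p hp ht]].
  by rewrite mem_filter /= => /andP[/andP[hp /eqP->] ht] ->; exists p.
by exists (p, a, q) => //; rewrite mem_filter /= hp eqxx.
Qed.

Lemma mem_foldl_step S u q :
  q \in foldl (aut_step (aut_of A)) S u <-> exists2 p, p \in S & nfa_run A p u q.
Proof.
elim: u S => [|a u IHu] S /=; first by split=> [?|[p hp <-]] //; exists q.
split=> [/IHu[p /mem_aut_step[r hr ht] hp]|[p hp [r ht hr]]].
  by exists r => //; exists p.
by apply/IHu; exists r => //; apply/mem_aut_step; exists p.
Qed.

Lemma mem_grow S q : q \in aut_grow (aut_of A) S <->
  q \in S \/ exists p a, p \in S /\ (p, a, q) \in ntrans A.
Proof.
rewrite mem_cat; split=> [/orP[->|/mapP[[[p a] q'] /=]]|]; first by left.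
  by rewrite mem_filter /= => /andP[hp ht] ->; right; exists p, a.
move=> [->//|[p [a [hp ht]]]]; apply/orP; right.
by apply/mapP; exists (p, a, q) => //; rewrite mem_filter /= hp.
Qed.

Lemma grow_run K S q : q \in iter K (aut_grow (aut_of A)) S ->
  exists p z, p \in S /\ nfa_run A p z q.
Proof.
elim: K q => [|K IHK] q /=; first by exists q, [::].
case/mem_grow=> [/IHK//|[p [a [/IHK[r [z [hr hz]]] ht]]]].
exists r, (rcons z a); split=> //; rewrite -cats1; apply/nfa_run_cat.
by exists p => //; exists q.
Qed.

Lemma iter_growS K S q : q \in S -> q \in iter K (aut_grow (aut_of A)) S.
Proof. by elim: K => //= K IHK /IHK h; apply/mem_grow; left. Qed.

Let edge p q := has (fun t => (t.1.1 == p) && (t.2 == q)) (ntrans A).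

Lemma edgeP p q : reflect (exists a, (p, a, q) \in ntrans A) (edge p q).
Proof.
apply: (iffP hasP) => [[[[p' a] q'] ht /andP[/eqP <- /eqP <-]]|[a ht]]; first by exists a.
by exists (p, a, q) => //; rewrite !eqxx.
Qed.

Lemma path_grow K S p s : p \in S -> path edge p s -> size s <= K ->
  last p s \in iter K (aut_grow (aut_of A)) S.
Proof.
elim: s p S K => [|q s IHs] p S K hp /=; first by move=> _ _; exact: iter_growS.
case: K => // K /andP[/edgeP[a ht] hs] sK; rewrite iterSr; apply: IHs => //.
by apply/mem_grow; right; exists p, a.
Qed.

Lemma run_path p u q : nfa_run A p u q -> exists2 s, path edge p s & last p s = q.
Proof.
elim: u p => [p <-|a u IHu p [r ht /IHu[s hs ls]]]; first by exists [::].
by exists (r :: s) => //=; rewrite hs andbT; apply/edgeP; exists a.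
Qed.

(* Any reachable state is reached by a simple path, of length less than the
   number of states. *)
Lemma run_grow K S p u q : nst A <= K -> p < nst A -> p \in S -> nfa_run A p u q ->
  q \in iter K (aut_grow (aut_of A)) S.
Proof.
move=> AK pA pS /run_path[s]; case/shortenP=> s' hs' us' _ <-.
apply: path_grow => //; apply: leq_trans AK.
have sub : {subset p :: s' <= iota 0 (nst A)}.
  move=> x; rewrite inE mem_iota => /predU1P[->//|] {us'}.
  elim: s' p hs' {pS pA} => //= y s' IHs' p /andP[/edgeP[a /wf_trans[_ _ hy]] hs'].
  by rewrite inE => /predU1P[->|/(IHs' _ hs')].
by apply: ltnW; have := uniq_leq_size us' sub; rewrite size_iota.
Qed.

Lemma liveP K u : nst A <= K -> reflect (prefix_lang A u) (live K (aut_of A) u).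
Proof.
move=> AK; apply: (iffP hasP) => [[f /grow_run[q [z [/mem_foldl_step[p hp hq] hf]]] fA]|].
  by apply/prefix_langP; exists p, q, z; split=> //; apply/acc_from_fin; exists f.
move=> /prefix_langP[p [q [z [hp hq /acc_from_fin[f hf fA]]]]]; exists f => //.
apply: run_grow hf => //; last by apply/mem_foldl_step; exists p.
by apply: nfa_run_lt hq _; exact: wf_init.
Qed.

(** Lists the states met at the boundaries between copies of [u], so that a repetition among them
    can be found by counting. *)
Lemma rep_states N u p q : nfa_run A p (rep N u [::]) q ->
  exists s, [/\ size s = N.+1, nth 0 s 0 = p &
    forall i j, i <= j -> j <= N -> nfa_run A (nth 0 s i) (rep (j - i) u [::]) (nth 0 s j)] /\
    nth 0 s N = q.
Proof.
elim: N p => [|N IHN] p /=.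
  by move=> <-; exists [:: p]; split=> //; split=> // -[|i] [|j].
case/nfa_run_cat=> r hr /IHN[s [[ss s0 hs] sN]]; exists (p :: s); split=> //.
split=> //=; first by rewrite ss.
move=> [|i] [|j] //=; last by rewrite !ltnS subSS; exact: hs.
by move=> _ jN; apply/nfa_run_cat; exists r => //; rewrite -s0 -[j in rep j]subn0; exact: hs.
Qed.

(* Some state repeats along the [N] copies of [u], hence the copies between the
   two occurrences can be iterated. *)
Lemma prefix_lang_pump N x u n : nst A <= N -> prefix_lang A (x ++ rep N u [::]) ->
  prefix_lang A (x ++ rep n u [::]).
Proof.
move=> AN /prefix_langP[p [q [z [hp /nfa_run_cat[r hr hq] hz]]]].
have rA : r < nst A by apply: nfa_run_lt hr _; exact: wf_init.
have [s [[ss s0 hs] sN]] := rep_states hq.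
have /(uniqPn 0)[i [j [ij js eij]]] : ~~ uniq s.
  apply/negP => us; have sub : {subset s <= iota 0 (nst A)}.
    move=> y /(nthP 0)[i]; rewrite ss ltnS => iN <-; rewrite mem_iota /=.
    by apply: nfa_run_lt (hs 0 i _ iN) _; rewrite ?s0.
  by have := uniq_leq_size us sub; rewrite size_iota ss; lia.
rewrite ss ltnS in js.
have loop m : nfa_run A r (rep (i + m * (j - i)) u [::]) (nth 0 s j).
  elim: m => [|m IHm]; first by rewrite addn0 -eij -s0 -{1}[i]subn0; apply: hs; lia.
  rewrite (_ : i + m.+1 * (j - i) = (i + m * (j - i)) + (j - i)); last by lia.
  rewrite repD rep_nil; apply/nfa_run_cat; exists (nth 0 s j) => //.
  by rewrite -{1}eij; apply: hs => //; lia.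
have big : n <= i + n * (j - i) by rewrite (leq_trans _ (leq_addl _ _)) // leq_pmulr // subn_gt0.
(* [n] copies form a prefix of [i + n * (j - i)] copies, a number reached by going round the loop
   [n] times. *)
apply: (@prefix_lang_cat _ _ (rep (i + n * (j - i) - n) u [::])).
rewrite -catA rep_cat /= -repD subnKC //.
apply/prefix_langP; exists p, (nth 0 s j), (rep (N - j) u [::] ++ z); split=> //.
  by apply/nfa_run_cat; exists r.
by apply/acc_from_cat; exists q => //; rewrite -sN; apply: hs; lia.
Qed.

End Live.

(** * Pumped sequences *)

Lemma mkseq_cat T (w : nat -> T) m n :
  mkseq w (m + n) = mkseq w m ++ mkseq (fun i => w (m + i)) n.
Proof. by rewrite /mkseq iotaD map_cat add0n -[X in iota X n]addn0 iotaDl -map_comp. Qed.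

Lemma take_mkseq T (w : nat -> T) m n : m <= n -> take m (mkseq w n) = mkseq w m.
Proof. by move=> mn; rewrite -(subnKC mn) mkseq_cat take_size_cat ?size_mkseq. Qed.

Lemma eq_mkseq_lt T (v w : nat -> T) n :
  (forall i, i < n -> v i = w i) -> mkseq v n = mkseq w n.
Proof. by move=> vw; apply/eq_in_map => i; rewrite mem_iota => /vw. Qed.

Lemma mkseq_periodic T (w : nat -> T) p n s : (forall i, w (i + p) = w i) ->
  rep n (mkseq w p) (mkseq w s) = mkseq w (n * p + s).
Proof.
move=> wp; elim: n => // n IHn; rewrite mulSn -addnA mkseq_cat /= -/(rep _ _ _) IHn.
by congr cat; apply: eq_mkseq_lt => i _; rewrite addnC wp.
Qed.

Lemma periodic_mul T (w : nat -> T) a p q :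
  (forall i, a <= i -> w (i + p) = w i) -> forall i, a <= i -> w (i + q * p) = w i.
Proof.
move=> wp; elim: q => [|q IHq] i ai; first by rewrite addn0.
by rewrite mulSn addnCA addnC wp ?IHq //; apply: leq_trans ai (leq_addr _ _).
Qed.

Definition cat_morph (T U : Type) (phi : seq T -> seq U) :=
  forall s t, phi (s ++ t) = phi s ++ phi t.

Section CatMorph.

Variables (T U : Type) (phi : seq T -> seq U).
Hypothesis phiD : cat_morph phi.

Lemma cat_morph_rep n u v : phi (rep n u v) = rep n (phi u) (phi v).
Proof. by elim: n => //= n IHn; rewrite phiD -/(rep _ _ _) IHn. Qed.

Lemma size_cat_morph w m n : m <= n -> size (phi (mkseq w m)) <= size (phi (mkseq w n)).
Proof. by move=> mn; rewrite -(subnKC mn) mkseq_cat phiD size_cat leq_addr. Qed.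

(** The images of the prefixes of [w] extend one another, so they are prefixes of one infinite word.
    Its letter [i] is read at a chosen instant [late i] where it has been produced; letters never
    produced are arbitrary. *)
Lemma limit_word (x0 : U) w : exists W, forall t, phi (mkseq w t) = mkseq W (size (phi (mkseq w t))).
Proof.
pose late i := epsilon (inhabits 0) (fun t => i < size (phi (mkseq w t))).
exists (fun i => nth x0 (phi (mkseq w (late i))) i) => t.
apply: (@eq_from_nth _ x0) => [|i hi]; first by rewrite size_mkseq.
rewrite nth_mkseq //.
have hl : i < size (phi (mkseq w (late i))).
  by apply: (epsilon_spec (inhabits 0) (fun t => i < size (phi (mkseq w t)))); exists t.
by case: (leqP t (late i)) => [|/ltnW] /subnKC <-; rewrite mkseq_cat phiD nth_cat ?hi ?hl.
Qed.

End CatMorph.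

Definition pump_seq (T : Type) (w : nat -> T) i j : nat -> T :=
  fun t => if t < i then w t else w (i + (t - i) %% (j - i)).

Section PumpSeq.

Variables (T : Type) (w : nat -> T) (i j : nat).
Hypothesis ij : i < j.

Lemma pump_seq_lt t : t < j -> pump_seq w i j t = w t.
Proof.
rewrite /pump_seq; case: (ltnP t i) => // it tj; rewrite modn_small; last by lia.
by rewrite subnKC.
Qed.

Lemma pump_seq_periodic t : i <= t -> pump_seq w i j (t + (j - i)) = pump_seq w i j t.
Proof.
move=> it; rewrite /pump_seq (leq_gtF it) (leq_gtF (leq_trans it (leq_addr _ _))).
by rewrite -addnBAC // modnDr.
Qed.

Lemma pump_seq_end : pump_seq w i j j = w i.
Proof. by rewrite /pump_seq (leq_gtF (ltnW ij)) modnn addn0. Qed.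

Lemma mkseq_pump n r : r <= j - i ->
  mkseq (pump_seq w i j) (i + (n * (j - i) + r)) =
  mkseq w i ++ rep n (mkseq (fun t => w (i + t)) (j - i)) (mkseq (fun t => w (i + t)) r).
Proof.
move=> rij; rewrite mkseq_cat; congr cat.
  by apply: eq_mkseq_lt => t ti; apply: pump_seq_lt; apply: ltn_trans ij.
rewrite -mkseq_periodic; last first.
  by move=> t; rewrite addnA pump_seq_periodic // leq_addr.
by congr rep; apply: eq_mkseq_lt => t ht; apply: pump_seq_lt; lia.
Qed.

Lemma pump_seq_split t : t < i \/ exists n r, r < j - i /\ t = i + (n * (j - i) + r).
Proof.
case: (ltnP t i) => it; [by left | right].
exists ((t - i) %/ (j - i)), ((t - i) %% (j - i)).
by rewrite ltn_mod subn_gt0 ij -divn_eq subnKC.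
Qed.

Lemma pump_seq_in t : exists2 t', t' < j & pump_seq w i j t = w t'.
Proof.
rewrite /pump_seq; case: (ltnP t i) => it; first by exists t => //; apply: ltn_trans ij.
exists (i + (t - i) %% (j - i)) => //; have : (t - i) %% (j - i) < j - i by rewrite ltn_mod subn_gt0.
by lia.
Qed.

(** The check at [t.+1 = j] covers the junction where the sequence jumps back to [w i]; every later
    step is a translate of an earlier one by the period. *)
Lemma pump_seq_chain (R : T -> T -> Prop) :
  (forall t, t.+1 <= j -> R (pump_seq w i j t) (pump_seq w i j t.+1)) ->
  forall t, R (pump_seq w i j t) (pump_seq w i j t.+1).
Proof.
move=> hR; elim/ltn_ind=> t IHt; case: (ltnP t j) => [/hR//|jt].
have -> : t = (t - (j - i)) + (j - i) by lia.
by rewrite -addSn !pump_seq_periodic; [apply: IHt; lia | lia | lia].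
Qed.

End PumpSeq.

(** * Soundness of pumping *)

Lemma sendw_cat c : cat_morph (sendw c).
Proof. by move=> s t; rewrite /sendw filter_cat map_cat. Qed.

Lemma recvw_cat c : cat_morph (recvw c).
Proof. by move=> s t; rewrite /recvw filter_cat map_cat. Qed.

Lemma connectedP w n : connected (mkseq w n) <->
  (0 < n -> (w 0).1.1 = 0) /\ forall t, t.+1 < n -> (w t.+1).1.1 = (w t).2.
Proof.
have -> : connected (mkseq w n) =
    (mkseq (fun t => (w t).1.1) n == mkseq (fun t => if t is t'.+1 then (w t').2 else 0) n).
  rewrite /connected size_mkseq -!map_comp; congr eq_op.
  have sz : size (take n (0 :: map (snd \o w) (iota 0 n))) = n.
    by rewrite size_take /= size_map size_iota ltnS leqnn.
  apply: (@eq_from_nth _ 0) => [|t]; rewrite sz ?size_mkseq // => tn.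
  rewrite nth_take // nth_mkseq //; case: t tn => //= t tn.
  by rewrite (nth_mkseq 0 (snd \o w)) // ltnW.
split=> [/eqP h|[h0 h]].
  have at_t t : t < n -> (w t).1.1 = if t is t'.+1 then (w t').2 else 0.
    by move=> tn; move: (congr1 (fun s => nth 0 s t) h); rewrite !nth_mkseq.
  by split=> [/at_t|t /at_t].
by apply/eqP/eq_mkseq_lt => -[|t] tn; [exact: h0 | exact: h].
Qed.

Definition fifo_at c (w : nat -> trans) t :=
  recvw c (mkseq w t) = take (size (recvw c (mkseq w t))) (sendw c (mkseq w t)).

Lemma fifo_okP c w n : fifo_ok c (mkseq w n) <-> forall t, t <= n -> fifo_at c w t.
Proof.
rewrite /fifo_ok size_mkseq; split=> [/allP h t tn|h].
  by have := h t; rewrite take_mkseq // mem_iota /= add0n ltnS tn => /(_ isT)/eqP.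
by apply/allP => t; rewrite mem_iota /= add0n ltnS => tn; rewrite take_mkseq //; apply/eqP/h.
Qed.

Lemma fifo_at_size c w t : fifo_at c w t ->
  size (recvw c (mkseq w t)) <= size (sendw c (mkseq w t)).
Proof. by move=> h; rewrite h size_take; case: ltnP => // /ltnW. Qed.

(** When the words sent and received are prefixes of one infinite word, the queue discipline reduces
    to a comparison of lengths. *)
Lemma fifo_at_mkseq c w t W a b :
  recvw c (mkseq w t) = mkseq W a -> sendw c (mkseq w t) = mkseq W b -> a <= b ->
  fifo_at c w t.
Proof. by rewrite /fifo_at => -> -> ab; rewrite size_mkseq take_mkseq. Qed.

Lemma periodic_word (x u : seq nat) : exists W,
  (forall a, size x <= a -> W (a + size u) = W a) /\
  forall n v s, u = v ++ s -> x ++ rep n u v = mkseq W (size x + (n * size u + size v)).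
Proof.
pose V t := nth 0 u (t %% size u).
exists (fun a => if a < size x then nth 0 x a else V (a - size x)); split=> [a xa|n v s uE].
  by rewrite !ltnNge xa (leq_trans xa (leq_addr _ _)) /= -addnBAC // /V modnDr.
rewrite mkseq_cat; congr cat.
  by rewrite -{1}(mkseq_nth 0 x); apply: eq_mkseq_lt => t ->.
have uV m : m <= size u -> mkseq V m = take m u.
  move=> mu; rewrite -[in RHS](mkseq_nth 0 u) take_mkseq //.
  by apply: eq_mkseq_lt => t tm; rewrite /V modn_small // (leq_trans tm).
have {1}-> : v = mkseq V (size v) by rewrite uV uE ?take_size_cat // size_cat leq_addr.
have {1}-> : u = mkseq V (size u) by rewrite uV // take_size.
rewrite mkseq_periodic => [|t]; last by rewrite /V modnDr.
by apply: eq_mkseq_lt => t _; rewrite ltnNge leq_addr /= addKn.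
Qed.

(* The words sent and received along [pump_seq w i j] are eventually periodic;
   agreeing on a long enough prefix, they agree everywhere. *)
Lemma fifo_pump c w i j N : i < j -> j < N ->
  (forall t, t <= i + N * (j - i) -> fifo_at c (pump_seq w i j) t) ->
  forall t, fifo_at c (pump_seq w i j) t.
Proof.
move=> ij jN ok; set w' := pump_seq w i j in ok *.
pose seg r := mkseq (fun t => w (i + t)) r.
have seg_cat r : r <= j - i -> exists s, seg (j - i) = seg r ++ s.
  by move=> /subnKC rj; eexists; rewrite -[in LHS]rj /seg mkseq_cat.
pose x := sendw c (mkseq w i); pose u := sendw c (seg (j - i)).
pose y := recvw c (mkseq w i); pose v := recvw c (seg (j - i)).
have [W [Wper Wword]] := periodic_word x u.
have [V [Vper Vword]] := periodic_word y v.
pose sz n r := i + (n * (j - i) + r).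
have sendE n r : r <= j - i ->
    sendw c (mkseq w' (sz n r)) = mkseq W (size x + (n * size u + size (sendw c (seg r)))).
  move=> rj; rewrite mkseq_pump // sendw_cat (cat_morph_rep (@sendw_cat c)).
  by have [s us] := seg_cat r rj; apply: (Wword _ _ (sendw c s)); rewrite -sendw_cat -us.
have recvE n r : r <= j - i ->
    recvw c (mkseq w' (sz n r)) = mkseq V (size y + (n * size v + size (recvw c (seg r)))).
  move=> rj; rewrite mkseq_pump // recvw_cat (cat_morph_rep (@recvw_cat c)).
  by have [s us] := seg_cat r rj; apply: (Vword _ _ (recvw c s)); rewrite -recvw_cat -us.
have seg0 : seg 0 = [::] by [].
have size_le n r : r <= j - i -> n * (j - i) + r <= N * (j - i) ->
    size y + (n * size v + size (recvw c (seg r))) <=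
    size x + (n * size u + size (sendw c (seg r))).
  move=> rj nN; have := @fifo_at_size c w' (sz n r).
  by rewrite sendE // recvE // !size_mkseq; apply; apply: ok; rewrite /sz leq_add2l.
(* A transition sends at most one letter, so preperiod plus period of the word sent is at most [j],
   hence less than [N]. *)
have xu : size x + size u <= j.
  rewrite -size_cat -sendw_cat /seg -mkseq_cat subnKC ?(ltnW ij) //.
  by rewrite size_map size_filter (leq_trans (count_size _ _)) // size_mkseq.
have yx : size y <= size x.
  by have := size_le 0 0; rewrite seg0 /= !addn0; apply.
(* If a round received more than it sends, [N] rounds would more than make up for the initial lead,
   at most [size x < N], and receptions would outnumber sends. *)
have vu : size v <= size u.
  have := size_le N 0; rewrite seg0 /= !addn0 leqnn => /(_ isT isT).
  by move=> h; rewrite leqNgt; apply/negP => uv; nia.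
have segv r : r <= j - i -> size (recvw c (seg r)) <= size v.
  by move=> rj; rewrite /v; have [s ->] := seg_cat r rj; rewrite recvw_cat size_cat leq_addr.
have agree0 a : a < size y + N * size v -> V a = W a.
  move=> ha; have := ok (sz N 0); rewrite /fifo_at /sz addn0 leqnn => /(_ isT).
  rewrite -[N * _ in X in X -> _]addn0 sendE // recvE // seg0 /= !addn0 size_mkseq.
  have := size_le N 0; rewrite seg0 /= !addn0 leqnn => /(_ isT isT) le.
  by rewrite take_mkseq // => /(congr1 (fun s => nth 0 s a)); rewrite !nth_mkseq.
(* Beyond the range of [agree0], step back by [size u * size v], a multiple of both periods; [N] is
   large enough for the result to stay in the periodic part of both words. *)
have agree : 0 < size v -> forall a, V a = W a.
  move=> v0; elim/ltn_ind=> a IHa; case: (ltnP a (size y + N * size v)) => [|ha].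
    exact: agree0.
  have big : size x + size u * size v <= a by nia.
  have -> : a = (a - size u * size v) + size u * size v by lia.
  rewrite (periodic_mul _ Vper); last by lia.
  rewrite [size u * _]mulnC (periodic_mul _ Wper); last by rewrite mulnC; lia.
  by rewrite IHa // mulnC; nia.
move=> t; case: (pump_seq_split ij t) => [ti|[n [r [rj ->]]]]; first by apply: ok; lia.
move/ltnW in rj; rewrite -/(sz n r).
have le : size y + (n * size v + size (recvw c (seg r))) <=
          size x + (n * size u + size (sendw c (seg r))).
  have := size_le 0 r rj; rewrite !mul0n !add0n.
  have : r <= N * (j - i) by nia.
  by move=> rN /(_ rN) h; have := leq_mul (leqnn n) vu; lia.
apply: (fifo_at_mkseq _ (sendE n r rj) le); rewrite recvE //; apply: eq_mkseq_lt => a ha.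
case: (posnP (size v)) => [v0|/agree //]; apply: agree0.
by have := segv r rj; move: ha; rewrite v0; lia.
Qed.

(** * Finding a pumpable segment *)

(** Induction on [m]: an index that fails at some [n0] fails at all larger values by monotonicity,
    so the remaining indices suffice. *)
Lemma finite_pigeonhole m (Q : nat -> nat -> Prop) :
  (forall n, exists2 k, k < m & Q k n) ->
  (forall k n n', n <= n' -> Q k n' -> Q k n) ->
  exists2 k, k < m & forall n, Q k n.
Proof.
elim: m => [|m IHm] hQ mono; first by case: (hQ 0).
case: (classic (forall n, Q m n)) => [hm|/not_all_ex_not[n0 hn0]]; first by exists m.
case: IHm => // [n|k km hk]; last by exists k => //; exact: ltnW.
have [k km hk] := hQ (maxn n n0).
exists k; last by apply: mono hk; exact: leq_maxl.
move: km; rewrite ltnS leq_eqVlt => /predU1P[km|//]; case: hn0.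
by rewrite -km; apply: mono hk; exact: leq_maxr.
Qed.

Lemma monotone_dichotomy (f : nat -> nat) : {homo f : m n / m <= n} ->
  (forall n, exists t, n <= f t) \/ exists T, forall t, T <= t -> f t = f T.
Proof.
move=> fm; case: (classic (forall n, exists t, n <= f t)) => [|hb]; first by left.
right; apply: NNPP => hT; apply: hb; elim=> [|n [t ht]]; first by exists 0.
have [t' tt'] := not_all_ex_not _ _ (not_ex_all_not _ _ hT t).
have [le ne] := imply_to_and _ _ tt'; exists t'.
by have := fm _ _ le; rewrite leq_eqVlt => /predU1P[/esym//|]; lia.
Qed.

(** An infinite set of instants. Extracting a subsequence amounts to passing to a smaller unbounded
    predicate, which keeps the original indices. *)
Definition unbounded (P : nat -> Prop) := forall n, exists2 t, n <= t & P t.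

Definition sub_pred (P Q : nat -> Prop) := forall t, P t -> Q t.

(** Keep the instants of [P] whose value is minimal among the later ones. They occur beyond any [n]:
    from an instant that does not qualify, move to a later one of smaller value, and descend. *)
Lemma unbounded_mono (f : nat -> nat) P : unbounded P ->
  exists P', [/\ unbounded P', sub_pred P' P &
    forall i j, P' i -> P' j -> i <= j -> f i <= f j].
Proof.
move=> uP; exists (fun t => P t /\ forall t', t <= t' -> P t' -> f t <= f t').
split=> [n|t []//|i j [_ hi] [hj _] ij]; last exact: hi.
have [t0 nt0 Pt0] := uP n.
elim/ltn_ind: (f t0) {-2}t0 (erefl (f t0)) nt0 Pt0 => v IHv t ftv nt Pt.
case: (classic (forall t', t <= t' -> P t' -> f t <= f t')) => [h|]; first by exists t.
case/not_all_ex_not=> t' h; have [tt' h'] := imply_to_and _ _ h.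
have [Pt' /negP] := imply_to_and _ _ h'; rewrite -ltnNge ftv => lt.
by apply: (IHv _ lt t') => //; apply: leq_trans tt'.
Qed.

Lemma unbounded_const (f : nat -> nat) B P : (forall t, f t <= B) -> unbounded P ->
  exists P', [/\ unbounded P', sub_pred P' P &
    forall i j, P' i -> P' j -> i <= j -> f i = f j].
Proof.
move=> fB uP; have [P1 [u1 s1 m1]] := unbounded_mono f uP.
have [P2 [u2 s2 m2]] := unbounded_mono (fun t => B - f t) u1.
exists P2; split=> // [t /s2/s1//|i j Pi Pj ij].
have := m1 i j (s2 _ Pi) (s2 _ Pj) ij; have := m2 i j Pi Pj ij.
by have := fB i; have := fB j; lia.
Qed.

(** The successive extractions of Dickson's lemma, with [c] as coordinate: each refinement preserves
    what was obtained for earlier coordinates. *)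
Lemma unbounded_all m (G : nat -> nat -> nat -> Prop) P :
  (forall c, c < m -> forall P, unbounded P ->
     exists P', [/\ unbounded P', sub_pred P' P & forall i j, P' i -> P' j -> i < j -> G c i j]) ->
  unbounded P -> exists P', [/\ unbounded P', sub_pred P' P &
    forall c i j, c < m -> P' i -> P' j -> i < j -> G c i j].
Proof.
elim: m => [|m IHm] hG uP; first by exists P; split.
have [c cm|P1 [u1 s1 g1]] := IHm _ uP; first by apply: hG; exact: ltnW.
have [P2 [u2 s2 g2]] := hG m (ltnSn m) P1 u1.
exists P2; split=> // [t /s2/s1//|c i j].
rewrite ltnS leq_eqVlt => /predU1P[->|cm] Pi Pj ij; first exact: g2.
by apply: g1 => //; exact: s2.
Qed.

Lemma nth_rep (u v : seq nat) n a : a < n * size u ->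
  nth 0 (rep n u v) a = nth 0 u (a %% size u).
Proof.
elim: n a => // n IHn a ha; rewrite /= nth_cat; case: ltnP => au; first by rewrite modn_small.
rewrite -/(rep _ _ _) IHn; last by move: ha; rewrite mulSn; lia.
by congr nth; rewrite -[in RHS](subnK au) modnDr.
Qed.

Lemma in_bounded_cons w ws u : in_bounded (w :: ws) u ->
  exists k u', u = rep k w u' /\ in_bounded ws u'.
Proof.
move=> [[|k ks] [//= [sk] ->]]; exists k; eexists; split; last by exists ks.
by elim: k => //= k <-; rewrite catA.
Qed.

(** Induction on [ws]. Unless [W] is [w] repeated for ever, it deviates from that word at some [a0],
    which limits the leading block to at most [a0] copies of [w]. By pigeonhole one number [k] of
    copies serves for all prefixes, and the rest of [W] is handled by [ws]. *)
Lemma bounded_word_periodic ws (W : nat -> nat) : all (fun w => w != [::]) ws ->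
  (forall n, exists z, in_bounded ws (mkseq W n ++ z)) ->
  exists P p, 0 < p /\ forall a, P <= a -> W (a + p) = W a.
Proof.
elim: ws W => [|w ws IHws] W /= => [_ h|/andP[w0 hws] hW].
  by have [z [[|k ks] []]] := h 1.
case: (classic (forall a, W a = nth 0 w (a %% size w))) => [per|].
  exists 0, (size w); rewrite lt0n size_eq0 w0; split=> // a _.
  by rewrite !per modnDr.
case/not_all_ex_not=> a0 ha0.
pose Q k n := exists z u', mkseq W n ++ z = rep k w u' /\ in_bounded ws u'.
have [n|k n n' nn' [z [u' [e h]]]|k ka hk] := @finite_pigeonhole a0.+1 Q.
- have [z /in_bounded_cons[k [u' [e h]]]] := hW (n + a0.+1); exists k; last first.
    exists (mkseq (fun i => W (n + i)) a0.+1 ++ z), u'; split=> //.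
    by rewrite catA -mkseq_cat.
  rewrite ltnS leqNgt; apply/negP => ak; apply: ha0.
  have sw : 0 < size w by rewrite lt0n size_eq0.
  have := congr1 (fun s => nth 0 s a0) e; rewrite nth_cat size_mkseq.
  have -> : a0 < n + a0.+1 by lia.
  rewrite nth_mkseq; last by lia.
  by move=> ->; apply: nth_rep; rewrite (leq_trans ak) // leq_pmulr.
- exists (mkseq (fun i => W (n + i)) (n' - n) ++ z), u'; split=> //.
  by rewrite catA -mkseq_cat subnKC.
have [|P [p [p0 per]]] := IHws (fun i => W (k * size w + i)) hws.
  move=> n; have [z [u' [e h]]] := hk (k * size w + n); exists z.
  suff -> : mkseq (fun i => W (k * size w + i)) n ++ z = u' by [].
  move/(congr1 (drop (k * size w))): e.
  rewrite mkseq_cat -catA drop_size_cat ?size_mkseq // => ->.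
  rewrite rep_nil drop_size_cat //; elim: (k) => //= m IHm.
  by rewrite size_cat -/(rep _ _ _) IHm mulSn.
exists (k * size w + P), p; split=> // a ha.
have -> : a = k * size w + (a - k * size w) by lia.
by rewrite -addnA per //; lia.
Qed.

Section PumpedWord.

Variables (phi : seq trans -> seq nat) (w : nat -> trans) (W : nat -> nat).
Hypothesis phiD : cat_morph phi.
Let f t := size (phi (mkseq w t)).
Hypothesis phiW : forall t, phi (mkseq w t) = mkseq W (f t).

(** If the length gained from [i] to [j] is a period of [W] from [f i] on, pumping reproduces [W]:
    the pumped images are prefixes of the same infinite word. *)
Lemma pumped_word i j n r : i < j -> r <= j - i ->
  (forall a, f i <= a -> W (a + (f j - f i)) = W a) ->
  phi (mkseq (pump_seq w i j) (i + (n * (j - i) + r))) =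
  mkseq W (f i + (n * (f j - f i) + (f (i + r) - f i))).
Proof.
move=> ij rj per; rewrite mkseq_pump // phiD (cat_morph_rep phiD) phiW mkseq_cat.
congr cat; have seg m : phi (mkseq (fun t => w (i + t)) m) =
    mkseq (fun a => W (f i + a)) (f (i + m) - f i).
  have := phiW (i + m); rewrite {1}mkseq_cat phiD phiW.
  have le : f i <= f (i + m) by apply: size_cat_morph => //; exact: leq_addr.
  rewrite -[in RHS](subnKC le) mkseq_cat => /eqP.
  by rewrite eqseq_cat // eqxx => /eqP.
rewrite !seg subnKC ?(ltnW ij) // mkseq_periodic // => a.
by rewrite addnA per // leq_addr.
Qed.

End PumpedWord.

Lemma eqmod_period (W : nat -> nat) P p a b :
  (forall x, P <= x -> W (x + p) = W x) -> P <= a -> a <= b -> a %% p = b %% p ->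
  forall x, a <= x -> W (x + (b - a)) = W x.
Proof.
move=> per Pa ab e x ax; have /dvdnP[q ->] : p %| b - a.
  by rewrite -eqn_mod_dvd // e.
by apply: (periodic_mul _ per); apply: leq_trans ax.
Qed.

(** With [R] and [S] counting the letters received and sent, [S - R] is the channel length; a round
    does not shorten it, so whole rounds inserted before the partial one preserve [R <= S]. *)
Lemma pumped_length Ri Rj Rr Si Sj Sr n : Rr <= Sr -> Ri <= Rj -> Si <= Sj ->
  Ri <= Rr -> Si <= Sr -> Ri <= Si -> Rj <= Sj -> Si - Ri <= Sj - Rj ->
  Ri + (n * (Rj - Ri) + (Rr - Ri)) <= Si + (n * (Sj - Si) + (Sr - Si)).
Proof.
move=> ? ? ? ? ? ? ? ?; have d : Rj - Ri <= Sj - Si by lia.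
by have := leq_mul (leqnn n) d; lia.
Qed.

(** Refine [P] until the lengths sent and received are constant modulo a suitable [p] and the
    channel length is nondecreasing. Pumping between two such instants yields prefixes of the same
    limit word, with lengths in the right order. *)
Lemma channel_pump A c w P : bounded_lang (nfa_lang A) ->
  (forall t, prefix_lang A (sendw c (mkseq w t))) -> (forall t, fifo_at c w t) ->
  unbounded P ->
  exists P', [/\ unbounded P', sub_pred P' P & forall i j, P' i -> P' j -> i < j ->
    forall t, prefix_lang A (sendw c (mkseq (pump_seq w i j) t)) /\
              fifo_at c (pump_seq w i j) t].
Proof.
move=> [ws [ws0 bnd]] lv ok uP.
have [W sendE] := limit_word (@sendw_cat c) 0 w.
pose S t := size (sendw c (mkseq w t)); pose R t := size (recvw c (mkseq w t)).
have RS t : R t <= S t by exact: fifo_at_size.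
have recvE t : recvw c (mkseq w t) = mkseq W (R t).
  by rewrite ok sendE take_mkseq; last exact: RS.
have Sm : {homo S : m n / m <= n} by move=> m n; exact: (size_cat_morph (@sendw_cat c)).
have Rm : {homo R : m n / m <= n} by move=> m n; exact: (size_cat_morph (@recvw_cat c)).
have lvW t n : n <= S t -> prefix_lang A (mkseq W n).
  move=> nS; have := lv t; rewrite sendE -/(S t) -(subnKC nS) mkseq_cat.
  exact: prefix_lang_cat.
(* If infinitely many letters are sent, [p] is a period of the limit word; otherwise sends and
   receptions both stop, and [p] is 1. A count that has stopped has increment 0, for which
   periodicity is trivial. *)
have [p [T [p0 perS perR stop]]] : exists p T, [/\ 0 < p,
   forall i j, T <= i -> i <= j -> S i %% p = S j %% p ->
     forall a, S i <= a -> W (a + (S j - S i)) = W a,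
   forall i j, T <= i -> i <= j -> R i %% p = R j %% p ->
     forall a, R i <= a -> W (a + (R j - R i)) = W a &
   (forall n, exists t, n <= S t) \/ (forall i j, T <= i -> i <= j -> S j = S i)].
  have const f T : (forall t, T <= t -> f t = f T) ->
      forall i j, T <= i -> i <= j -> f j = f i :> nat.
    by move=> h i j Ti ij; rewrite !h // (leq_trans Ti).
  have const_per f T : (forall t, T <= t -> f t = f T) ->
      forall i j, T <= i -> i <= j -> forall a, W (a + (f j - f i)) = W a.
    by move=> h i j Ti ij a; rewrite (const f T h i j) // subnn addn0.
  case: (monotone_dichotomy Sm) => [Sinf|[TS hS]]; last first.
    case: (monotone_dichotomy Rm) => [Rinf|[TR hR]].
      have [t ht] := Rinf (S TS).+1.
      have := leq_trans ht (leq_trans (RS t) (Sm _ _ (leq_maxl t TS))).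
      by rewrite hS ?leq_maxr // ltnn.
    exists 1, (maxn TS TR); split=> //.
    - by move=> i j; rewrite geq_max => /andP[hi _] ij _ a _; exact: (const_per S TS hS).
    - by move=> i j; rewrite geq_max => /andP[_ hi] ij _ a _; exact: (const_per R TR hR).
    - by right=> i j; rewrite geq_max => /andP[hi _] ij; exact: (const S TS hS).
  have [|B [p [p0 per]]] := bounded_word_periodic (W := W) ws0.
    move=> n; have [t /lvW[z /bnd h]] := Sinf n; by exists z.
  have [TS hTS] := Sinf B.
  case: (monotone_dichotomy Rm) => [Rinf|[TR hR]].
    have [TR hTR] := Rinf B; exists p, (maxn TS TR); split=> //; last by left.
    - move=> i j; rewrite geq_max => /andP[hi _] ij e; apply: (eqmod_period per) => //.
        by apply: leq_trans hTS (Sm _ _ hi).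
      exact: Sm.
    - move=> i j; rewrite geq_max => /andP[_ hi] ij e; apply: (eqmod_period per) => //.
        by apply: leq_trans hTR (Rm _ _ hi).
      exact: Rm.
  exists p, (maxn TS TR); split=> //; last by left.
  - move=> i j; rewrite geq_max => /andP[hi _] ij e; apply: (eqmod_period per) => //.
      by apply: leq_trans hTS (Sm _ _ hi).
    exact: Sm.
  - by move=> i j; rewrite geq_max => /andP[_ hi] ij _ a _; exact: (const_per R TR hR).
have uT : unbounded (fun t => P t /\ T <= t).
  move=> n; have [t] := uP (maxn n T); rewrite geq_max => /andP[nt Tt] Pt; by exists t.
have modp x : x %% p <= p by rewrite ltnW // ltn_mod.
have [P1 [u1 s1 m1]] := unbounded_const (fun t => modp (S t)) uT.
have [P2 [u2 s2 m2]] := unbounded_const (fun t => modp (R t)) u1.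
have [P3 [u3 s3 m3]] := unbounded_mono (fun t => S t - R t) u2.
exists P3; split=> // [t /s3/s2/s1[]//|i j Pi Pj ij].
have [ij' [_ Ti]] := (ltnW ij, s1 _ (s2 _ (s3 _ Pi))).
have eS := m1 i j (s2 _ (s3 _ Pi)) (s2 _ (s3 _ Pj)) ij'.
have eR := m2 i j (s3 _ Pi) (s3 _ Pj) ij'.
have le := m3 i j Pi Pj ij'; rewrite /= in eS eR le.
move=> t; case: (pump_seq_split ij t) => [ti|[n [r [rj ->]]]].
  have e : mkseq (pump_seq w i j) t = mkseq w t.
    by apply: eq_mkseq_lt => t' ht; apply: pump_seq_lt => //; lia.
  by rewrite /fifo_at e; split; [exact: lv | exact: ok].
move/ltnW in rj.
have sE := pumped_word (@sendw_cat c) sendE n ij rj (perS i j Ti ij' eS).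
have rE := pumped_word (@recvw_cat c) recvE n ij rj (perR i j Ti ij' eR).
split; last first.
  apply: (fifo_at_mkseq rE sE).
  by apply: (@pumped_length (R i) (R j) (R (i + r)) (S i) (S j) (S (i + r)));
    rewrite ?RS ?Sm ?Rm ?leq_addr.
(* If infinitely many letters are sent, every prefix of [W] is live; otherwise the loop sends
   nothing and the word is one already sent along [w]. *)
rewrite sE -/(S _) -/(S j) -/(S i); case: stop => [Sinf|Sst].
  by have [t' /lvW] := Sinf (S i + (n * (S j - S i) + (S (i + r) - S i))).
rewrite (Sst i j) // subnn muln0 add0n subnKC ?Sm ?leq_addr //.
exact: (lvW (i + r)).
Qed.

(** * Executions of FIFO machines *)

Lemma mem_words n d l : (l \in words n d) = (size l == n) && all (fun t => t \in d) l.
Proof.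
elim: n l => [|n IHn] l; first by rewrite inE /words /=; case: l.
apply/flatten_mapP/andP => [[t td /mapP[l' + ->]]|[]].
  by rewrite -/(words n d) IHn /= td => /andP[/eqP-> ->].
case: l => // t l; rewrite /= eqSS => sl /andP[td ld]; exists t => //.
by apply/mapP; exists l => //; rewrite -/(words n d) IHn sl.
Qed.

Section Machine.

Variables (M : fifo) (Ls : seq nfa).
Hypotheses (wfM : wf_fifo M) (wfL : wf_langs M Ls).

Let chan c := nth (Nfa 0 [::] [::] [::]) Ls c.

Definition exec l := connected l /\
  forall c, c < nC M -> prefix_lang (chan c) (sendw c l) /\ fifo_ok c l.

Definition exec_seq w := (forall t, w t \in delta M) /\ forall n, exec (mkseq w n).

Lemma chan_wf c : c < nC M -> wf_nfa (nth 0 (alph M) c) (chan c).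
Proof. by move=> cM; case: wfL => _ /(_ c cM)[]. Qed.

Lemma chan_bound c : c < nC M -> nst (chan c) <= state_bound (encode M Ls).
Proof.
case: wfL => <- _; rewrite /state_bound /encode /= /chan.
elim: Ls c => //= A s IHs [|c] /=; first by rewrite leq_addr.
by rewrite ltnS => /IHs h; rewrite (leq_trans h) // leq_addl.
Qed.

Lemma fireableP l : reflect (exec l) (fireable (encode M Ls) l).
Proof.
have chanE c : c < nC M -> nth aut0 (encode M Ls).2 c = aut_of (chan c).
  by case: wfL => <- _ cM; rewrite /encode /= (nth_map (Nfa 0 [::] [::] [::])).
apply: (iffP andP) => [[hc /allP h]|[hc h]]; split=> //.
  move=> c cM; have := h c; rewrite mem_iota => /(_ cM); rewrite chanE //.
  by case/andP=> /(liveP (chan_wf cM) _ (chan_bound cM)).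
apply/allP => c; rewrite mem_iota => cM; have [hl hf] := h c cM.
by rewrite chanE // hf andbT; apply/(liveP (chan_wf cM) _ (chan_bound cM)).
Qed.

Lemma exec_mkseq w m n : m <= n -> exec (mkseq w n) -> exec (mkseq w m).
Proof.
move=> mn [/connectedP[h0 h1] h]; split.
  by apply/connectedP; split=> [m0|t tm]; [apply: h0 | apply: h1]; apply: leq_trans mn.
move=> c /h[hl /fifo_okP hf]; split.
  by move: hl; rewrite -(subnKC mn) mkseq_cat sendw_cat; exact: prefix_lang_cat.
by apply/fifo_okP => t tm; apply: hf; exact: leq_trans mn.
Qed.

Lemma exec_cat l1 l2 : exec (l1 ++ l2) -> exec l1.
Proof.
pose t0 : trans := (0, (0, false, 0), 0).
rewrite -{1}(mkseq_nth t0 (l1 ++ l2)) size_cat => /(exec_mkseq (leq_addr _ _)).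
by rewrite -{3}(mkseq_nth t0 l1); congr exec; apply: eq_mkseq_lt => i h; rewrite nth_cat h.
Qed.

(* Koenig's lemma: follow transitions that keep arbitrarily long extensions. *)
Lemma exec_seq_limit :
  (forall n, exists l, [/\ size l = n, all (fun t => t \in delta M) l & exec l]) ->
  exists w, exec_seq w.
Proof.
pose t0 : trans := (0, (0, false, 0), 0).
pose ext l n := exists l', [/\ size l' = n, all (fun t => t \in delta M) l' & exec (l ++ l')].
move=> h0; have step l : (forall n, ext l n) ->
    exists t, t \in delta M /\ forall n, ext (rcons l t) n.
  move=> hl; have [n|k n n' nn' [l' [sl hd he]]|k kd hk] :=
      @finite_pigeonhole (size (delta M)) (fun k n => ext (rcons l (nth t0 (delta M) k)) n).
  - have [[|t l'] [//= [sl] /andP[td hd] he]] := hl n.+1.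
    exists (index t (delta M)); first by rewrite index_mem.
    by exists l'; rewrite nth_index // cat_rcons.
  - exists (take n l'); split; first by rewrite size_take sl; case: ltngtP nn'.
      by move: hd; rewrite -{1}(cat_take_drop n l') all_cat => /andP[].
    by move: he; rewrite -{1}(cat_take_drop n l') catA => /exec_cat.
  - by exists (nth t0 (delta M) k); rewrite mem_nth.
pose next l := epsilon (inhabits t0) (fun t => t \in delta M /\ forall n, ext (rcons l t) n).
pose L := fix L n := if n is n'.+1 then rcons (L n') (next (L n')) else [::].
have hL n : forall m, ext (L n) m.
  elim: n => [|n IHn]; first exact: h0.
  by have [] := epsilon_spec (inhabits t0) _ (step _ IHn).
exists (fun n => next (L n)); split=> [n|n].
  by have [] := epsilon_spec (inhabits t0) _ (step _ (hL n)).
have -> : mkseq (fun n => next (L n)) n = L n.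
  by elim: n => // n IHn; rewrite mkseqS IHn.
by have [l' [_ _ /exec_cat]] := hL n 0.
Qed.

Lemma pump_mkseq (w : nat -> trans) i j N : i < j ->
  pump i N (mkseq w j) = mkseq (pump_seq w i j) (i + (N * (j - i) + 0)).
Proof.
move=> ij; rewrite mkseq_pump // /pump take_mkseq ?(ltnW ij) //.
congr (_ ++ iter _ (cat _) _).
by rewrite -{1}(subnKC (ltnW ij)) mkseq_cat drop_size_cat ?size_mkseq.
Qed.

(** Refine to instants with the same control state, then channel by channel; any two remaining
    instants [i < j] give the certificate. *)
Lemma exec_seq_pumpable w : exec_seq w -> exists n, pumpable (encode M Ls) n.
Proof.
move=> [wd we]; have uT : unbounded (fun=> True) by move=> n; exists n.
have srcM t : (w t).1.1 <= nQ M.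
  by case: wfM => _ [_ /allP/(_ _ (wd t))/and3P[/ltnW]].
have path_w t : (w t.+1).1.1 = (w t).2.
  by have [/connectedP[_ h] _] := we t.+2; apply: h.
have src0 : (w 0).1.1 = 0 by have [/connectedP[h _] _] := we 1; apply: h.
have [P1 [u1 _ q1]] := unbounded_const srcM uT.
have [c cM P uP|P2 [u2 s2 g2]] := @unbounded_all (nC M) (fun c i j =>
    forall t, prefix_lang (chan c) (sendw c (mkseq (pump_seq w i j) t)) /\
              fifo_at c (pump_seq w i j) t) P1 _ u1.
  apply: channel_pump uP; first by case: wfL => _ /(_ c cM)[_ []].
  - by move=> t; have [_ /(_ c cM)[]] := we t.
  - by move=> t; have [_ /(_ c cM)[_ /fifo_okP]] := we t; apply.
have [i _ Pi] := u2 0; have [j ij Pj] := u2 i.+1.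
exists j; apply/hasP; exists (mkseq w j).
  rewrite mem_words size_mkseq eqxx; apply/allP => t /mapP[t' _ ->]; exact: wd.
apply/hasP; exists i; first by rewrite mem_iota.
rewrite pump_mkseq //; apply/fireableP; split; last first.
  move=> c cM; split.
    by case: (g2 c i j cM Pi Pj ij (i + ((state_bound (encode M Ls) + j).+1 * (j - i) + 0))).
  by apply/fifo_okP => t _; case: (g2 c i j cM Pi Pj ij t).
apply/connectedP; split=> [_|t _].
  by rewrite pump_seq_lt //; apply: leq_ltn_trans ij.
apply/esym; apply: (pump_seq_chain ij (R := fun s t => s.2 = t.1.1)) => {}t tj.
rewrite (pump_seq_lt w ij (t := t)) // -path_w.
move: tj; rewrite leq_eqVlt => /predU1P[->|tj]; last by rewrite pump_seq_lt.
(* At the junction, the target of the last transition is the source at [j], which equals the source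
   at [i]. *)
by rewrite pump_seq_end //; apply/esym/q1; [exact: s2 | exact: s2 | exact: ltnW].
Qed.

Lemma pumpable_exec_seq n : pumpable (encode M Ls) n -> exists w, exec_seq w.
Proof.
case/hasP=> l; rewrite mem_words => /andP[/eqP sl ld] /hasP[i].
rewrite mem_iota add0n /= => ij.
pose t0 : trans := (0, (0, false, 0), 0).
rewrite -{1}(mkseq_nth t0 l) sl pump_mkseq // addn0; set w := nth t0 l.
set N := (_ + n).+1 => /fireableP[/connectedP[h0 h1] h].
have Nn : n < N by rewrite ltnS leq_addl.
exists (pump_seq w i n); split=> [t|m].
  have [t' tn ->] := pump_seq_in w ij t.
  by apply: (allP ld); rewrite mem_nth // sl.
have big : n < i + N * (n - i) by nia.
split.
  apply/connectedP; split=> [_|t _]; first by apply: h0; apply: leq_ltn_trans big.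
  apply/esym; apply: (pump_seq_chain ij (R := fun s t => s.2 = t.1.1)) => {}t tn.
  by rewrite h1 //; apply: leq_ltn_trans big.
move=> c cM; have [hl /fifo_okP hf] := h c cM; split; last first.
  by apply/fifo_okP => t _; exact: (fifo_pump ij Nn hf).
case: (pump_seq_split ij m) => [mi|[k [r [rn ->]]]].
  move: hl; have /subnKC <- : m <= i + N * (n - i) by lia.
  by rewrite mkseq_cat sendw_cat; exact: prefix_lang_cat.
move: hl; rewrite -[N * _]addn0 !mkseq_pump ?(ltnW rn) // !sendw_cat.
rewrite !(cat_morph_rep (@sendw_cat c)).
have NA : nst (chan c) <= N by rewrite (leq_trans (chan_bound cM)) // leqW // leq_addr.
(* One copy more than [k]: the partial copy of length [r] is a prefix of the last one. *)
move/(prefix_lang_pump (chan_wf cM) k.+1 NA).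
rewrite -[k.+1]addn1 repD /= cats0.
rewrite -{2}(subnKC (ltnW rn)) (mkseq_cat _ r) sendw_cat -rep_cat catA.
exact: prefix_lang_cat.
Qed.

(** * Sequences of transitions and executions over configurations *)

Lemma sendw_proj c (w : nat -> trans) n :
  sendw c (mkseq w n) = proj_send c (mkseq (fun t => (w t).1.2) n).
Proof.
rewrite /proj_send (_ : mkseq _ n = [seq t.1.2 | t <- mkseq w n]); last by rewrite -map_comp.
by rewrite filter_map -map_comp.
Qed.

Lemma proj_send_cat c s s' : proj_send c (s ++ s') = proj_send c s ++ proj_send c s'.
Proof. by rewrite /proj_send filter_cat map_cat. Qed.

(** Projections to distinct channels are independent, so the completions for the channels can be
    appended one after the other. The induction records that channels not yet treated receive no
    letter; letters are valid because the automata only read letters of the alphabet. *)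
Lemma in_PrefP s : in_Pref_Lsend M Ls s <->
  forall c, c < nC M -> prefix_lang (chan c) (proj_send c s).
Proof.
split=> [[s' [_ h]] c cM|h].
  by exists (proj_send c s'); have := h c cM; rewrite proj_send_cat.
suff [s' [vs hs _]] : exists s', [/\ all (valid_action M) s',
    forall c, c < nC M -> nfa_lang (chan c) (proj_send c s ++ proj_send c s') &
    forall c, nC M <= c -> proj_send c s' = [::]].
  by exists s'; split=> // c cM; rewrite proj_send_cat; exact: hs.
elim: {-2}(nC M) (leqnn (nC M)) => [|m IHm] mM; first by exists [::].
have [s' [vs hs es]] := IHm (ltnW mM).
have [z hz] := h m mM.
have lz : all (fun a => a < nth 0 (alph M) m) z.
  have [p _ /acc_from_letters-/(_ _ (chan_wf mM))] := hz.
  by rewrite all_cat => /andP[].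
exists (s' ++ [seq (m, true, a) | a <- z]).
have pz c : proj_send c [seq (m, true, a) | a <- z] = if m == c then z else [::].
  elim: (z) => [|a z' IHz]; first by rewrite if_same.
  rewrite -cat1s map_cat proj_send_cat IHz /proj_send /= /act_ch /act_send /= andbT.
  by case: (m == c).
split.
- rewrite all_cat vs all_map; apply/allP => a az; rewrite /= /valid_action /act_ch /= mM.
  exact: (allP lz).
- move=> c; rewrite ltnS leq_eqVlt proj_send_cat pz eq_sym => /predU1P[<-|cm].
    by rewrite eqxx es.
  by rewrite (gtn_eqF cm) cats0; exact: hs.
- move=> c mc; rewrite proj_send_cat pz (ltn_eqF mc) cats0.
  by rewrite es // ltnW.
Qed.

Lemma sendwS c (w : nat -> trans) t : sendw c (mkseq w t.+1) = sendw c (mkseq w t) ++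
  (if ((w t).1.2.1.1 == c) && (w t).1.2.1.2 then [:: (w t).1.2.2] else [::]).
Proof.
by rewrite mkseqS -cats1 sendw_cat /sendw /=; case: ifP.
Qed.

Lemma recvwS c (w : nat -> trans) t : recvw c (mkseq w t.+1) = recvw c (mkseq w t) ++
  (if ((w t).1.2.1.1 == c) && ~~ (w t).1.2.1.2 then [:: (w t).1.2.2] else [::]).
Proof.
by rewrite mkseqS -cats1 recvw_cat /recvw /=; case: ifP.
Qed.

(** [IB_terminates] unfolds to the negation of this statement. *)
Definition nonterminating := exists (s : nat -> config) (b : nat -> action),
  s 0 = init_config M /\
  forall i, fstep M (s i) (b i) (s i.+1) /\ valid_action M (b i) /\
            in_Pref_Lsend M Ls (mkseq b i.+1).

Lemma nonterminating_exec : nonterminating -> exists w, exec_seq w.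
Proof.
move=> [s [b [s0 hs]]]; pose w t : trans := ((s t).1, b t, (s t.+1).1).
(* Queue invariant: what was sent is what was received followed by the channel content. *)
have queue c t : sendw c (mkseq w t) = recvw c (mkseq w t) ++ nth [::] (s t).2 c.
  elim: t => [|t IHt]; first by rewrite s0 /= nth_nseq if_same.
  rewrite sendwS recvwS IHt /w /=; have [[_]] := hs t.
  rewrite -/(act_ch (b t)) -/(act_send (b t)) -/(act_letter (b t)) /=.
  case: (act_send (b t)) => [->|[e1 e2]].
    rewrite andbF andbT cats0 nth_set_nth /= eq_sym.
    by case: eqP => [->|_]; rewrite ?cats0 // -catA cats1.
  rewrite andbF andbT cats0 -catA; case: eqP => [ec|/eqP nc] /=; first by rewrite -ec e1.
  by rewrite e2 nth_set_nth /= eq_sym (negPf nc).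
exists w; split=> [t|n]; first by case: (hs t) => [[]].
split.
  by apply/connectedP; split=> //; rewrite /w /= s0.
move=> c cM; split.
  (* The hypothesis speaks of nonempty action sequences, so the prefix of length [n] is obtained
     from that of length [n.+1]. *)
  rewrite sendw_proj; apply: (@prefix_lang_cat _ _ (proj_send c [:: b n])).
  rewrite -proj_send_cat; have [_ [_ /in_PrefP/(_ c cM)]] := hs n.
  by rewrite mkseqS -cats1.
by apply/fifo_okP => t _; rewrite /fifo_at queue take_size_cat.
Qed.

(** The channel contents are recovered as the part of the word sent that has not yet been
    received. *)
Lemma exec_nonterminating w : exec_seq w -> nonterminating.
Proof.
move=> [wd we].
pose q t c := drop (size (recvw c (mkseq w t))) (sendw c (mkseq w t)).
have queue t c : c < nC M -> sendw c (mkseq w t) = recvw c (mkseq w t) ++ q t c.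
  move=> cM; have [_ /(_ c cM)[_ /fifo_okP/(_ t (leqnn t)) h]] := we t.
  by rewrite {1}h cat_take_drop.
pose st t := if t is t'.+1 then (w t').2 else 0.
have stE t : (w t).1.1 = st t.
  case: t => [|t]; first by have [/connectedP[h _] _] := we 1; apply: h.
  by have [/connectedP[_ h] _] := we t.+2; apply: h.
exists (fun t => (st t, mkseq (q t) (nC M))), (fun t => (w t).1.2); split.
  rewrite /init_config /=; congr pair; apply: (@eq_from_nth _ [::]).
    by rewrite size_mkseq size_nseq.
  by move=> c; rewrite size_mkseq => cM; rewrite nth_mkseq // nth_nseq cM.
move=> t; have /andP[cM aM] : valid_action M (w t).1.2.
  by case: wfM => _ [_ /allP/(_ _ (wd t))/and3P[]].
split; last first.
  split; first by apply/andP.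
  by apply/in_PrefP => c cM'; rewrite -sendw_proj; have [_ /(_ c cM')[]] := we t.+1.
(* Cancelling the word received from the invariant at [t.+1] leaves the effect of one transition: a
   send appends at the tail, a reception removes the head. *)
have qS c : c < nC M -> (if ((w t).1.2.1.1 == c) && ~~ (w t).1.2.1.2
      then [:: (w t).1.2.2] else [::]) ++ q t.+1 c =
    q t c ++ (if ((w t).1.2.1.1 == c) && (w t).1.2.1.2 then [:: (w t).1.2.2] else [::]).
  move=> cM'; have := queue t.+1 c cM'; rewrite sendwS recvwS (queue t c cM') -!catA.
  by move/eqP; rewrite eqseq_cat // eqxx => /eqP.
have szE (x : seq nat) : size (set_nth [::] (mkseq (q t) (nC M)) (act_ch (w t).1.2) x) = nC M.
  by rewrite size_set_nth size_mkseq; apply/maxn_idPr.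
split=> /=; first by rewrite -stE; have := wd t; case: (w t) => [[? ?] ?].
rewrite /act_ch in cM szE *; case sd: (act_send _).
  apply: (@eq_from_nth _ [::]) => [|c]; rewrite ?szE ?size_mkseq // => cM'.
  rewrite nth_set_nth /= !nth_mkseq //; have := qS c cM'.
  rewrite -[(w t).1.2.1.2]/(act_send (w t).1.2) sd andbF andbT /= => ->.
  by rewrite eq_sym; case: eqP => [->|_]; rewrite ?cats1 // cats0.
rewrite !nth_mkseq //; split.
  have := qS _ cM; rewrite -[(w t).1.2.1.2]/(act_send (w t).1.2) sd eqxx /= cats0.
  by move=> <-.
apply: (@eq_from_nth _ [::]) => [|c]; rewrite ?szE ?size_mkseq // => cM'.
rewrite nth_set_nth /= !nth_mkseq //; have := qS c cM'.
rewrite -[(w t).1.2.1.2]/(act_send (w t).1.2) sd andbF andbT cats0 eq_sym.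
by case: eqP => [->|_].
Qed.

(** Makes the search stop: without an infinite execution, the contrapositive of Koenig's lemma gives
    a length that no execution has. *)
Lemma exhausted_or_pumpable :
  exists n, exhausted (encode M Ls) n || pumpable (encode M Ls) n.
Proof.
case: (classic (exists w, exec_seq w)) => [[w /exec_seq_pumpable[n hn]]|no].
  by exists n; rewrite hn orbT.
apply: NNPP => hno; apply: no; apply: exec_seq_limit => n; apply: NNPP => hl.
apply: hno; exists n; apply/orP; left; apply/allP => l; rewrite mem_words.
by move=> /andP[/eqP sl ld]; apply/fireableP => he; apply: hl; exists l.
Qed.

Lemma exhausted_terminates n : exhausted (encode M Ls) n -> IB_terminates M Ls.
Proof.
move=> /allP h /nonterminating_exec[w [wd we]].
have /h/fireableP : mkseq w n \in words n (delta M); last by apply.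
by rewrite mem_words size_mkseq eqxx; apply/allP => t /mapP[t' _ ->].
Qed.

Lemma pumpable_not_terminates n : pumpable (encode M Ls) n -> ~ IB_terminates M Ls.
Proof. by move=> /pumpable_exec_seq[w /exec_nonterminating h] ht; apply: ht. Qed.

End Machine.

Theorem theorem5p11 :
  exists P : seq cm_instr,
    forall (M : fifo) (Ls : seq nfa),
      wf_fifo M -> wf_langs M Ls ->
      cm_decides P (code M Ls) (IB_terminates M Ls).
Proof.
have [ta hta] := computable_exhausted.
have [tg htg] : computable (fun x : input * nat => ~~ (exhausted x.1 x.2 || pumpable x.1 x.2)).
  by apply/computable_neg/computable_or; [exact: computable_exhausted | exact: computable_pumpable].
(* The search looks for a zero of the negated test and outputs the truth value of [exhausted] there;
   when this is false, [pumpable] holds. *)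
have [P hP] := search_program (Comp (tPair (Var 1) (Var 0)) tg) (Comp (tPair (Var 1) (Var 0)) ta).
exists P => M Ls wfM wfL; pose x : input := encode M Ls.
have [|z] := hP (pickle x).
  have [n hn] := exhausted_or_pumpable wfM wfL; exists n.
  by rewrite (eval_curry htg) /x hn.
rewrite (eval_curry htg) (eval_curry hta) => hz [t [ht et]]; exists t; split; first exact: ht.
have {}hz : ~~ (exhausted x z || pumpable x z) = 0 :> nat := hz.
have {}et : (iter t (cm_step P) (cm_init (code M Ls))).2 0 = exhausted x z := et.
cbv zeta; rewrite et; case he: (exhausted x z) hz => /=.
  by left; split=> //; exact: exhausted_terminates he.
by case hp: (pumpable x z) => // _; right; split=> //; exact: pumpable_not_terminates hp.
Qed.
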